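(* $\Phi=\Theta$.
   Context: Graphs are finite, undirected, possibly with loops and parallel edges. A graph is non-separable if it is connected, has no cut-vertex, and either has no loops or has exactly one vertex and one edge. A block is a maximal non-separable subgraph; $b(G)$ is the number of blocks of $G$ having at least one edge. For vertices $u_1,u_2$, $G/u_1u_2$ denotes the graph obtained by identifying $u_1$ and $u_2$ (edges joining them become loops); $G/e$ is the contraction of edge $e$. $\Phi$ is the set of non-separable graphs $G$ with $|V(G)|\ge 2$ such that: (a') $G-e$ is non-separable for every edge $e$; (b') $b(G/e)$ is even for every edge $e$; (c') whenever $G_1,G_2$ are subgraphs of $G$ with $|E(G_1)|\ge 2$, $|E(G_2)|\ge 2$, $V(G_1)\cap V(G_2)=\{u_1,u_2\}$ (distinct vertices), $V(G_1)\cup V(G_2)=V(G)$, $E(G_1)\cap E(G_2)=\emptyset$, $E(G_1)\cup E(G_2)=E(G)$, the integers $b(G_1/u_1u_2)$, $b(G_1)-1$, $b(G_2)$ all have the same parity. Let $Z_3$ be the graph with two vertices and three parallel edges between them. For a graph $G$ and an edge $e$ of $G$ with ends $u_1,u_2$, $G(e)$ is the graph obtained from $G-e$ by adding a new vertex $w$ and two parallel edges joining $w$ and $u_1$ and two parallel edges joining $w$ and $u_2$. $\Theta$ is the smallest set of graphs containing $Z_3$ and containing $G(e)$ for every $G\in\Theta$ and every $e\in E(G)$. *)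

(* Defs.v *)
From HB Require Import structures.
From mathcomp Require Import all_boot.

Set Implicit Arguments.
Unset Strict Implicit.
Unset Printing Implicit Defensive.

(* Finite multigraphs (loops and parallel edges allowed).              *)
(* A graph is given by a finite vertex type, a finite edge type and an *)
(* endpoint map; the pair (u,v) is read as the UNORDERED pair {u,v}    *)
(* (a loop is an edge with equal ends).  All notions below are         *)
(* symmetric in the two ends.                                          *)
Record mgraph := MGraph {
  mvert : finType;
  medge : finType;
  mends : medge -> mvert * mvert }.

(* "Ambient" graphs: a vertex set and an edge set inside fixed ambient *)
(* finite types, with a fixed endpoint map.  This is used to speak     *)
(* about subgraphs, deletions and identifications.                     *)
Record agraph (T F : finType) := AGraph {
  aends : F -> T * T;
  avert : {set T};
  aedge : {set F} }.

Section Ambient.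
Variables (T F : finType).
Implicit Types (G : agraph T F).

Definition wf G :=
  [forall e in aedge G, ((aends G e).1 \in avert G) && ((aends G e).2 \in avert G)].

Definition adj G : rel T := fun x y =>
  [&& x \in avert G, y \in avert G &
      [exists e in aedge G, (aends G e == (x, y)) || (aends G e == (y, x))]].

Definition connected G :=
  (avert G != set0) &&
  [forall x in avert G, forall y in avert G, connect (adj G) x y].

Definition del_vertex G (v : T) : agraph T F :=
  AGraph (aends G) (avert G :\ v)
         [set e in aedge G | ((aends G e).1 != v) && ((aends G e).2 != v)].

Definition del_edge G (e : F) : agraph T F :=
  AGraph (aends G) (avert G) (aedge G :\ e).

(* v is a cut-vertex: G - v has more components than G, i.e. two       *)
(* vertices other than v joined in G are no longer joined in G - v.     *)
Definition cut_vertex G (v : T) :=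
  (v \in avert G) &&
  [exists x in avert G :\ v, exists y in avert G :\ v,
      connect (adj G) x y && ~~ connect (adj (del_vertex G v)) x y].

Definition is_loop G (e : F) := (aends G e).1 == (aends G e).2.
Definition has_loop G := [exists e in aedge G, is_loop G e].

Definition nonsep G :=
  [&& connected G, [forall v, ~~ cut_vertex G v] &
      ~~ has_loop G || ((#|avert G| == 1) && (#|aedge G| == 1))].

Definition sub G (p : {set T} * {set F}) : agraph T F :=
  AGraph (aends G) p.1 p.2.

Definition is_subgraph G (p : {set T} * {set F}) :=
  [&& p.1 \subset avert G, p.2 \subset aedge G & wf (sub G p)].

Definition is_block G (p : {set T} * {set F}) :=
  [&& is_subgraph G p, nonsep (sub G p) &
      [forall q : {set T} * {set F},
         [&& is_subgraph G q, p.1 \subset q.1, p.2 \subset q.2 & nonsep (sub G q)]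
           ==> (q == p)]].

Definition nblocks G : nat :=
  #|[set p : {set T} * {set F} | is_block G p && (p.2 != set0)]|.

Definition identify G (u1 u2 : T) : agraph T F :=
  if u1 == u2 then G else
  let f := fun x => if x == u2 then u1 else x in
  AGraph (fun e => (f (aends G e).1, f (aends G e).2)) (avert G :\ u2) (aedge G).

Definition contract G (e : F) : agraph T F :=
  identify (del_edge G e) (aends G e).1 (aends G e).2.

Definition PhiA G :=
  [/\ nonsep G, 2 <= #|avert G|,
      (forall e, e \in aedge G -> nonsep (del_edge G e)),
      (forall e, e \in aedge G -> ~~ odd (nblocks (contract G e))) &
      (forall (p1 p2 : {set T} * {set F}) (u1 u2 : T),
         is_subgraph G p1 -> is_subgraph G p2 ->
         2 <= #|p1.2| -> 2 <= #|p2.2| -> u1 != u2 ->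
         p1.1 :&: p2.1 = [set u1; u2] -> p1.1 :|: p2.1 = avert G ->
         p1.2 :&: p2.2 = set0 -> p1.2 :|: p2.2 = aedge G ->
         (* parity of b(G1/u1u2), b(G1)-1 and b(G2) agree;
            the parity of b(G1)-1 is that of b(G1)+1 *)
         odd (nblocks (identify (sub G p1) u1 u2)) = odd (nblocks (sub G p1)).+1 /\
         odd (nblocks (sub G p2)) = odd (nblocks (sub G p1)).+1)].

End Ambient.

Definition toA (G : mgraph) : agraph (mvert G) (medge G) :=
  AGraph (@mends G) setT setT.

Definition Phi (G : mgraph) : Prop := PhiA (toA G).

Definition iso (G H : mgraph) : Prop :=
  exists (fv : mvert G -> mvert H) (fe : medge G -> medge H),
    [/\ bijective fv, bijective fe &
        forall x, mends (fe x) = (fv (mends x).1, fv (mends x).2) \/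
                  mends (fe x) = (fv (mends x).2, fv (mends x).1)].

Definition Z3 : mgraph :=
  @MGraph (ordinal 2) (ordinal 3) (fun _ => (ord0, ord_max)).

(* G(e) : delete e = u1u2, add a new vertex w with two parallel edges  *)
(* w u1 and two parallel edges w u2.  New vertex = None, new edges =   *)
(* inr 0, inr 1 (to u1) and inr 2, inr 3 (to u2).                      *)
Definition extend (G : mgraph) (e : medge G) : mgraph :=
  @MGraph (option (mvert G)) ({x : medge G | x != e} + ordinal 4)%type
    (fun x => match x with
              | inl y => (Some (mends (val y)).1, Some (mends (val y)).2)
              | inr i => (None, Some (if (nat_of_ord i < 2)%N
                                      then (mends e).1 else (mends e).2))
              end).

Inductive Theta : mgraph -> Prop :=
| Theta_Z3 H : iso Z3 H -> Theta H
| Theta_ext G (e : medge G) H : Theta G -> iso (extend e) H -> Theta H.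

(* Main.v *)
(** Everything is expressed through edge sets.  An edge set is 2-connected
    ([conn2]) when each of its bipartitions shares at least two vertices; the
    blocks with an edge are the maximal 2-connected edge sets, so b is 1 on
    2-connected sets and additive over parts sharing at most one vertex, and
    these two rules compute it.

    Replacing an edge e by the gadget preserves 2-connectedness, hence b, unless
    e is a bridge; bridges are excluded because deleting e leaves a
    2-connected graph.  This carries the three conditions across the gadget in
    both directions.

    A graph of Phi with at least three vertices contains a gadget: its edges
    have separating end pairs by (b'), so there is a part P with at least three
    vertices meeting the rest in exactly two vertices u, v; take P minimal.  By
    minimality P/uv is a block, so b(P) is even by (c') and P splits at a
    vertex x into a u-x part and an x-v part.  Minimality makes each of them a
    class of parallel edges; (a') forbids a single edge and (c') forbids three
    or more.  A graph of Phi with two vertices is Z3 for the same parity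
    reasons. *)

Require Import Defs.
From Corelib Require Import Setoid.
From mathcomp Require Import all_boot perm.

Set Implicit Arguments.
Unset Strict Implicit.
Unset Printing Implicit Defensive.

(** With edge sets over an incidence map [inc : F -> {set T}], each operation in the definition of
    Phi acts on one coordinate: deletion shrinks the set, identification composes [inc] with a map
    of vertices, and the graph with [e] and the graph with the gadget are two sets over the same
    map. Isolated vertices, which (c') permits in its subgraphs, disappear. A bridge is the delicate
    case because [e] alone is one block, while the gadget alone is two, the classes [A] and [B]. The
    comparison of block numbers therefore assumes that the remaining edges link the ends of [e], and
    this has to be kept true inside the pieces of (c') and after identifications. Parity singles out
    pairs of edges: m parallel edges form one block, but m blocks, all loops, once their ends are
    identified. *)

Section FinsetFacts.
Variable F : finType.
Implicit Types A B Q X Y E : {set F}.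

Lemma card2_neq0 A : #|A| = 2 -> A != set0.
Proof. by rewrite -card_gt0 => ->. Qed.

Lemma disjointUl A B Q : [disjoint A :|: B & Q] -> [disjoint A & Q].
Proof. by apply: disjointWl; apply: subsetUl. Qed.

Lemma disjointUr A B Q : [disjoint A :|: B & Q] -> [disjoint B & Q].
Proof. by apply: disjointWl; apply: subsetUr. Qed.

End FinsetFacts.

(** * Blocks as maximal 2-connected edge sets *)

Section EdgeConnectivity.
Variables (T F : finType) (inc : F -> {set T}).
Implicit Types (X Y Z E A B P Q R : {set F}).

Definition vset E := \bigcup_(f in E) inc f.

Lemma vsetP x E : reflect (exists2 f, f \in E & x \in inc f) (x \in vset E).
Proof. exact: bigcupP. Qed.

Lemma mem_vset x f E : f \in E -> x \in inc f -> x \in vset E.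
Proof. by move=> fE xf; apply/vsetP; exists f. Qed.

Lemma vsetU A B : vset (A :|: B) = vset A :|: vset B.
Proof. by rewrite /vset bigcup_setU. Qed.

Lemma vsetS A B : A \subset B -> vset A \subset vset B.
Proof. by move=> /setUidPr <-; rewrite vsetU subsetUl. Qed.

Lemma vset1 f : vset [set f] = inc f.
Proof. by rewrite /vset big_set1. Qed.

Lemma vset0 : vset set0 = set0.
Proof. by rewrite /vset big_set0. Qed.

Lemma vset_parallel (S : {set T}) E : E != set0 -> {in E, forall f, inc f = S} -> vset E = S.
Proof.
move=> /set0Pn[c cE] H; apply/setP=> t; apply/vsetP/idP => [[f fC]|tS]; first by rewrite H.
by exists c; rewrite ?H.
Qed.

(* A single edge, even a loop, is 2-connected; a loop is in no larger such set. *)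
Definition conn2 E := (E != set0) &&
  [forall X : {set F}, [&& X \subset E, X != set0 & X != E] ==>
     (1 < #|vset X :&: vset (E :\: X)|)].

(** Stated pointwise so that it passes to smaller vertex sets without counting; [cut_le1P] gives the
    cardinality form. *)
Definition cut_le1 X Y := forall y z, y \in vset X -> y \in vset Y ->
  z \in vset X -> z \in vset Y -> y = z.

Lemma cut_le1P X Y : reflect (cut_le1 X Y) (#|vset X :&: vset Y| <= 1).
Proof.
apply: (iffP card_le1_eqP) => [H y z yX yY zX zY | H y z].
  by apply: H; rewrite inE ?yX ?zX.
by rewrite !inE => /andP[yX yY] /andP[zX zY]; apply: (H z y).
Qed.

Lemma cut_le1_sym X Y : cut_le1 X Y -> cut_le1 Y X.
Proof. by move=> H y z *; apply: H. Qed.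

Lemma conn2_neq0 E : conn2 E -> E != set0.
Proof. by case/andP. Qed.

Lemma setUD_sub X E : X \subset E -> X :|: E :\: X = E.
Proof.
move=> /subsetP sX; apply/setP=> f; rewrite !inE.
by case: (boolP (f \in X)) => // /sX ->.
Qed.

Lemma disjointD X E : [disjoint X & E :\: X].
Proof. by rewrite disjoint_sym -setI_eq0 setIDAC -setIDA setDv setI0. Qed.

Lemma disjoint_setUD X Y : [disjoint X & Y] -> (X :|: Y) :\: X = Y.
Proof. by move=> dXY; rewrite setDUl setDv set0U; apply/setDidPl; rewrite disjoint_sym. Qed.

Lemma conn2_cut X Y : conn2 (X :|: Y) -> X != set0 -> Y != set0 -> [disjoint X & Y] ->
  1 < #|vset X :&: vset Y|.
Proof.
move=> /andP[_ /forallP/(_ X)/implyP] + X0 Y0 dXY.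
rewrite (disjoint_setUD dXY); apply; rewrite subsetUl X0 /=.
apply: contra Y0 => /eqP eX; rewrite -(disjoint_setUD dXY) -eX.
by rewrite setDv.
Qed.

Lemma conn2_not_cut_le1 X Y : conn2 (X :|: Y) -> X != set0 -> Y != set0 -> [disjoint X & Y] ->
  ~ cut_le1 X Y.
Proof. by move=> cE X0 Y0 dXY /cut_le1P; rewrite leqNgt conn2_cut. Qed.

Lemma conn2I E : E != set0 ->
  (forall X Y, X :|: Y = E -> [disjoint X & Y] -> X != set0 -> Y != set0 ->
     cut_le1 X Y -> False) -> conn2 E.
Proof.
move=> E0 H; rewrite /conn2 E0; apply/forallP=> X; apply/implyP=> /and3P[sX X0 XE].
rewrite ltnNge; apply/negP => /cut_le1P; apply: H => //.
- exact: setUD_sub.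
- exact: disjointD.
by rewrite setD_eq0; apply: contra XE => sE; rewrite eqEsubset sX.
Qed.

Lemma conn2_split E : E != set0 -> ~~ conn2 E ->
  exists X Y, [/\ X :|: Y = E, [disjoint X & Y], X != set0, Y != set0 & cut_le1 X Y].
Proof.
move=> E0; rewrite /conn2 E0 /= negb_forall => /existsP[X].
rewrite negb_imply -leqNgt => /andP[/and3P[sX X0 XE] /cut_le1P sm].
exists X, (E :\: X); split=> //.
- exact: setUD_sub.
- exact: disjointD.
by rewrite setD_eq0; apply: contra XE => sE; rewrite eqEsubset sX.
Qed.

Lemma conn2_set1 f : conn2 [set f].
Proof.
apply: conn2I => [|X Y eXY dXY X0 Y0 _]; first by apply/set0Pn; exists f; rewrite set11.
have sX : X \subset [set f] by rewrite -eXY subsetUl.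
have sY : Y \subset [set f] by rewrite -eXY subsetUr.
have full Z : Z \subset [set f] -> Z != set0 -> Z = [set f].
  by rewrite subset1 => /orP[/eqP|->].
have eX := full X sX X0; have eY := full Y sY Y0.
by move: dXY; rewrite eX eY -setI_eq0 setIid => /eqP/setP/(_ f); rewrite !inE eqxx.
Qed.

(** A block with an edge is determined by its edges, so edge sets alone are counted; [nblocksE]
    proves the agreement with [nblocks]. *)
Definition nblk E := #|[set A : {set F} | maxset (fun B => (B \subset E) && conn2 B) A]|.

Lemma nblk_conn2 E : conn2 E -> nblk E = 1.
Proof.
move=> cE; rewrite /nblk; have -> : [set A | maxset (fun B => (B \subset E) && conn2 B) A] = [set E].
  apply/setP=> A; rewrite !inE; apply/maxsetP/eqP => [[/andP[sA _] H]|->].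
    by rewrite (H E) // subxx.
  by rewrite subxx; split=> // B /andP[sB _] sE; apply/eqP; rewrite eqEsubset sB.
by rewrite cards1.
Qed.

Lemma nblk0 : nblk set0 = 0.
Proof.
apply/eqP; rewrite cards_eq0; apply/eqP/setP=> A; rewrite !inE; apply/negP=> /maxsetP[/andP[]].
by rewrite subset0 => /eqP-> /conn2_neq0; rewrite eqxx.
Qed.

(** Otherwise the traces of [B] on [X] and [Y] would form a bipartition of [B] sharing at most one
    vertex. *)
Lemma conn2_sub_part X Y B : cut_le1 X Y -> [disjoint X & Y] -> conn2 B ->
  B \subset X :|: Y -> (B \subset X) || (B \subset Y).
Proof.
move=> sm dXY cB sB.
case: (eqVneq (B :&: X) set0) => [BX0|BX0].
  apply/orP; right; apply/subsetP=> f fB; have := subsetP sB f fB.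
  by rewrite inE => /orP[fX|//]; move/setP/(_ f): BX0; rewrite !inE fB fX.
case: (eqVneq (B :&: Y) set0) => [BY0|BY0].
  apply/orP; left; apply/subsetP=> f fB; have := subsetP sB f fB.
  by rewrite inE => /orP[//|fX]; move/setP/(_ f): BY0; rewrite !inE fB fX.
case: (@conn2_not_cut_le1 (B :&: X) (B :&: Y)) => //.
- by rewrite -setIUr (setIidPl sB).
- by apply: disjointWl (subsetIr _ _) _; apply: disjointWr (subsetIr _ _) _.
have sub Z t : t \in vset (B :&: Z) -> t \in vset Z by apply: subsetP; apply: vsetS; apply: subsetIr.
by move=> y z /sub yX /sub yY /sub zX /sub zY; apply: sm.
Qed.

(** Each 2-connected set lies on one side of the cut, so maximality in [X :|: Y] is maximality in
    that side; being nonempty, the set is not counted on both. *)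
Lemma nblk_split X Y : cut_le1 X Y -> [disjoint X & Y] -> nblk (X :|: Y) = nblk X + nblk Y.
Proof.
move=> sm dXY; rewrite /nblk -cardsUI.
set mX := [set A | maxset (fun B => (B \subset X) && _) A].
set mY := [set A | maxset (fun B => (B \subset Y) && _) A].
have -> : mX :&: mY = set0.
  apply/setP=> A; rewrite !inE; apply/negP => /andP[/maxsetP[/andP[AX cA] _] /maxsetP[/andP[AY _] _]].
  have : A \subset X :&: Y by rewrite subsetI AX.
  by move: dXY; rewrite -setI_eq0 => /eqP->; rewrite subset0 (negPf (conn2_neq0 cA)).
rewrite cards0 addn0; congr #|pred_of_set _|; apply/setP=> A; rewrite !inE.
apply/maxsetP/orP => [[/andP[sA cA] mA]|].
  case/orP: (conn2_sub_part sm dXY cA sA) => sA'; [left|right]; apply/maxsetP;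
    rewrite sA' cA; split=> // B /andP[sB cB] sAB; apply: mA => //; rewrite cB andbT;
    by apply: (subset_trans sB); rewrite ?subsetUl ?subsetUr.
have aux X1 Y1 B : [disjoint X1 & Y1] -> A \subset X1 -> A \subset B -> conn2 A -> B \subset Y1 -> False.
  move=> d AX AB cA BY; have : A \subset X1 :&: Y1 by rewrite subsetI AX (subset_trans AB).
  by move: d; rewrite -setI_eq0 => /eqP->; rewrite subset0 (negPf (conn2_neq0 cA)).
case=> /maxsetP[/andP[sA cA] mA].
  rewrite cA (subset_trans sA) ?subsetUl //; split=> // B /andP[sB cB] sAB.
  apply: mA => //; rewrite cB andbT; case/orP: (conn2_sub_part sm dXY cB sB) => // sBY.
  by case: (aux X Y B).
rewrite cA (subset_trans sA) ?subsetUr //; split=> // B /andP[sB cB] sAB.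
apply: mA => //; rewrite cB andbT; case/orP: (conn2_sub_part sm dXY cB sB) => // sBY.
by case: (aux Y X B) => //; rewrite disjoint_sym.
Qed.

Lemma nblk_set1 f : nblk [set f] = 1.
Proof. exact: nblk_conn2 (conn2_set1 f). Qed.

Lemma disjoint1D f A : [disjoint [set f] & A :\ f].
Proof. by rewrite disjoints1 !inE eqxx. Qed.

(** Loops at one vertex share only that vertex, so they split off one at a time. *)
Lemma nblk_loops s A : {in A, forall f, inc f = [set s]} -> nblk A = #|A|.
Proof.
move: {2}#|A| (erefl #|A|) => n; elim: n A => [|n IH] A cA lA.
  by rewrite (cards0_eq cA) nblk0 cards0.
have /set0Pn[f fA] : A != set0 by rewrite -card_gt0 cA.
move: cA; rewrite (cardsD1 f) fA => -[cA].
rewrite -{1}(setD1K fA) nblk_split ?nblk_set1 ?disjoint1D //.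
  by rewrite IH // => g; rewrite inE => /andP[_ /lA].
move=> y z; rewrite !vset1 lA // !inE => /eqP-> _ /eqP-> //.
Qed.

Lemma conn2_parallel S A : A != set0 -> {in A, forall f, inc f = S} -> 1 < #|S| -> conn2 A.
Proof.
move=> A0 pA S1; apply: conn2I => // X Y eXY _ X0 Y0 /cut_le1P.
have aux Z : Z \subset A -> Z != set0 -> S \subset vset Z.
  move=> sZ /set0Pn[f fZ]; rewrite -(pA f) ?(subsetP sZ) // -vset1; apply: vsetS; by rewrite sub1set.
rewrite leqNgt => /negP; apply; apply: (leq_trans S1); apply: subset_leq_card.
by rewrite subsetI !aux // -eXY ?subsetUl ?subsetUr.
Qed.

(** Removing [f] from a cut of [f |: E] leaves a cut of [E], unless [f] is a side by itself; in that
    case both its ends are shared. *)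
Lemma conn2_add E f : conn2 E -> 1 < #|inc f| -> inc f \subset vset E -> conn2 (f |: E).
Proof.
move=> cE f2 sf; case: (boolP (f \in E)) => fE; first by rewrite (setUidPr _) ?sub1set.
have aux X Y : X :|: Y = f |: E -> [disjoint X & Y] -> X != set0 -> Y != set0 -> f \in Y -> cut_le1 X Y -> False.
  move=> eXY dXY X0 Y0 fY sm.
  have fX : f \notin X by apply/negP=> fX; move: dXY; rewrite -setI_eq0 => /eqP/setP/(_ f); rewrite !inE fX fY.
  have eE : E = X :|: (Y :\ f).
    apply/setP=> g; move/setP/(_ g): eXY; rewrite !inE; case: (eqVneq g f) => [->|_] //=.
    by rewrite (negPf fX) (negPf fE).
  case: (eqVneq (Y :\ f) set0) => [Y1|Y1].
    move/cut_le1P: sm; rewrite leqNgt => /negP; apply; apply: (leq_trans f2); apply: subset_leq_card.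
    rewrite subsetI -{2}vset1 vsetS ?sub1set // andbT.
    by rewrite eE Y1 setU0 in sf.
  apply: (@conn2_not_cut_le1 X (Y :\ f)) => //; first by rewrite -eE.
    by apply: disjointWr dXY; apply: subsetDl.
  have sub t : t \in vset (Y :\ f) -> t \in vset Y by apply: subsetP; apply: vsetS; apply: subsetDl.
  by move=> y z yX /sub yY zX /sub zY; apply: sm.
apply: conn2I => [|X Y eXY dXY X0 Y0 sm]; first by apply/set0Pn; exists f; rewrite setU11.
have : f \in X :|: Y by rewrite eXY setU11.
rewrite inE => /orP[fX|fY]; last exact: (aux X Y).
by apply: (aux Y X) => //; [rewrite setUC|rewrite disjoint_sym|apply: cut_le1_sym].
Qed.

Lemma conn2_addU E A : conn2 E -> {in A, forall f, 1 < #|inc f| /\ inc f \subset vset E} -> conn2 (E :|: A).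
Proof.
move: {2}#|A| (erefl #|A|) => n; elim: n A => [|n IH] A cA cE lA.
  by rewrite (cards0_eq cA) setU0.
have /set0Pn[f fA] : A != set0 by rewrite -card_gt0 cA.
move: cA; rewrite (cardsD1 f) fA => -[cA].
have -> : E :|: A = f |: (E :|: A :\ f) by rewrite setUCA setD1K.
have [f1 f2] := lA f fA.
apply: conn2_add => //; last by rewrite vsetU (subset_trans f2) ?subsetUl.
by apply: IH => // g; rewrite inE => /andP[_ /lA].
Qed.

End EdgeConnectivity.

(** * Invariance under embeddings *)

Section Transport.
Variables (T F T' F' : finType) (inc : F -> {set T}) (inc' : F' -> {set T'}).
Variables (h : F -> F') (g : T -> T').
Hypothesis h_inj : injective h.
Hypothesis g_inj : injective g.
Hypothesis inc_hg : forall f, inc' (h f) = g @: inc f.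
Implicit Types (E X Y A : {set F}).

Lemma vset_transport E : vset inc' (h @: E) = g @: vset inc E.
Proof.
apply/setP=> y; apply/vsetP/imsetP => [[_ /imsetP[f fE ->]]|[x /vsetP[f fE xf] ->]].
  rewrite inc_hg => /imsetP[x xf ->]; exists x => //; exact: mem_vset xf.
by exists (h f); rewrite ?imset_f // inc_hg imset_f.
Qed.

Lemma cut_le1_transport X Y : cut_le1 inc' (h @: X) (h @: Y) <-> cut_le1 inc X Y.
Proof.
have e : #|vset inc' (h @: X) :&: vset inc' (h @: Y)| = #|vset inc X :&: vset inc Y|.
  by rewrite !vset_transport -imsetI ?card_imset // => x y _ _; apply: g_inj.
by split=> /cut_le1P H; apply/cut_le1P; rewrite -?e // e.
Qed.

Lemma disjoint_imset X Y : [disjoint h @: X & h @: Y] = [disjoint X & Y].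
Proof.
by rewrite -!setI_eq0 -imsetI ?imset_eq0 // => x y _ _; apply: h_inj.
Qed.

Lemma sub_imset_preim E (X' : {set F'}) : X' \subset h @: E ->
  exists2 X : {set F}, X' = h @: X & X \subset E.
Proof.
move=> sX; exists (h @^-1: X').
  apply/setP=> y; apply/idP/imsetP => [yX|[f]]; last by rewrite inE => fX ->.
  by have /imsetP[f fE yf] := subsetP sX y yX; exists f; rewrite // inE -yf.
apply/subsetP=> f; rewrite inE => /(subsetP sX).
by rewrite (mem_imset E f h_inj).
Qed.

Lemma imset_part E (X' Y' : {set F'}) : X' :|: Y' = h @: E ->
  exists X Y : {set F}, [/\ X' = h @: X, Y' = h @: Y & X :|: Y = E].
Proof.
move=> e; have [|X eX sX] := @sub_imset_preim E X'; first by rewrite -e subsetUl.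
have [|Y eY sY] := @sub_imset_preim E Y'; first by rewrite -e subsetUr.
by exists X, Y; split=> //; apply: (imset_inj h_inj); rewrite imsetU -eX -eY.
Qed.

Lemma conn2_transport E : conn2 inc' (h @: E) = conn2 inc E.
Proof.
apply/idP/idP => cE.
  apply: conn2I => [|X Y eXY dXY X0 Y0 sm]; first by have := conn2_neq0 cE; rewrite imset_eq0.
  apply: (@conn2_not_cut_le1 _ _ inc' (h @: X) (h @: Y)); rewrite ?imset_eq0 ?disjoint_imset //.
    by rewrite -imsetU eXY.
  exact/cut_le1_transport.
apply: conn2I => [|X' Y' /imset_part[X [Y [-> -> eXY]]]]; first by rewrite imset_eq0 (conn2_neq0 cE).
rewrite disjoint_imset !imset_eq0 => dXY X0 Y0 /cut_le1_transport.
by apply: conn2_not_cut_le1 => //; rewrite eXY.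
Qed.

Lemma nblk_transport E : nblk inc' (h @: E) = nblk inc E.
Proof.
rewrite /nblk -(card_imset _ (imset_inj h_inj)); congr #|pred_of_set _|.
apply/setP=> A'; rewrite inE.
apply/maxsetP/imsetP => [[/andP[sA' cA'] mA']|[A]].
  have [A eA sA] := sub_imset_preim sA'; exists A => //.
  rewrite inE; apply/maxsetP; rewrite sA -conn2_transport -eA cA'; split=> // B /andP[sB cB] sAB.
  apply: (imset_inj h_inj); rewrite -eA; apply: mA'; last by rewrite eA imsetS.
  by rewrite imsetS // conn2_transport.
rewrite inE => /maxsetP[/andP[sA cA] mA] ->; rewrite imsetS // conn2_transport cA; split=> // B' /andP[sB' cB'] sAB'.
have [B eB sB] := sub_imset_preim sB'; rewrite eB; suff -> : B = A by []; apply: mA.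
  by rewrite sB -conn2_transport -eB.
apply/subsetP=> f fA; rewrite -(mem_imset B f h_inj) -eB; apply: (subsetP sAB').
exact: imset_f.
Qed.

End Transport.

(** * Identification of two vertices *)

Section Identification.
Variables (T F : finType).
Implicit Types (inc : F -> {set T}) (E X Y : {set F}) (u v x y : T).

Definition idpt u v x := if x == v then u else x.

(** Only the incidence map changes, so one edge set can be measured before and after; an edge
    joining [u] and [v] becomes a singleton, that is, a loop. *)
Definition incid inc u v f := idpt u v @: inc f.

Lemma idpt_eq u v x y : idpt u v x = idpt u v y -> x != y -> (x \in [set u; v]) && (y \in [set u; v]).
Proof.
rewrite /idpt !inE; case: (eqVneq x v) => [->|xv]; case: (eqVneq y v) => [->|yv] //=.
- by move=> <- _; rewrite eqxx !orbT.
- by move=> -> _; rewrite eqxx !orbT.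
by move=> ->; rewrite eqxx.
Qed.

Lemma idptL u v : idpt u v u = u.
Proof. by rewrite /idpt; case: eqP. Qed.

Lemma idptR u v : idpt u v v = u.
Proof. by rewrite /idpt eqxx. Qed.

Lemma vset_identify inc u v E : vset (incid inc u v) E = idpt u v @: vset inc E.
Proof.
apply/setP=> y; apply/vsetP/imsetP => [[f fE /imsetP[x xf ->]]|[x /vsetP[f fE xf] ->]].
  by exists x => //; apply: mem_vset xf.
by exists f; rewrite ?imset_f.
Qed.

Lemma nblk_ext inc inc' E : inc =1 inc' -> nblk inc E = nblk inc' E.
Proof.
move=> e; rewrite -{2}(imset_id E); apply/esym/(@nblk_transport _ _ _ _ _ _ id id) => // f.
by rewrite imset_id.
Qed.

(** The transposition of [u] and [v] exchanges the two choices of the surviving vertex. *)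
Lemma nblk_incidC inc u v E : nblk (incid inc u v) E = nblk (incid inc v u) E.
Proof.
rewrite -{1}(imset_id E); apply: (@nblk_transport _ _ _ _ _ _ _ (tperm u v)) => [//||f].
  exact: perm_inj.
rewrite /incid -imset_comp; apply: eq_imset => x /=; rewrite /idpt.
case: (eqVneq x u) => [->|xu]; first by rewrite tpermR; case: eqVneq.
by case: (eqVneq x v) => [->|xv]; rewrite ?tpermR // tpermD // eq_sym.
Qed.

(* Isolated vertices in (c') are harmless: b only sees edges. *)
Definition PhiE inc E := [/\ conn2 inc E, 1 < #|vset inc E|,
  {in E, forall e, conn2 inc (E :\ e)},
  (forall e u v, e \in E -> inc e = [set u; v] -> ~~ odd (nblk (incid inc u v) (E :\ e))) &
  (forall X Y u v, X :|: Y = E -> [disjoint X & Y] -> 1 < #|X| -> 1 < #|Y| ->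
     u != v -> vset inc X :&: vset inc Y = [set u; v] ->
     odd (nblk (incid inc u v) X) = ~~ odd (nblk inc X) /\
     odd (nblk inc Y) = ~~ odd (nblk inc X))].

End Identification.

(** * Invariance of the three conditions *)

Section PhiTransport.
Variables (T F T' F' : finType) (inc : F -> {set T}) (inc' : F' -> {set T'}).
Variables (h : F -> F') (g : T -> T').
Hypothesis h_inj : injective h.
Hypothesis g_inj : injective g.
Hypothesis inc_hg : forall f, inc' (h f) = g @: inc f.
Implicit Types (E X Y A : {set F}).

Lemma incid_transport u v f : incid inc' (g u) (g v) (h f) = g @: incid inc u v f.
Proof.
rewrite /incid inc_hg -!imset_comp; apply: eq_imset => x /=.
by rewrite /idpt (inj_eq g_inj); case: eqP.
Qed.

Lemma nblk_incid_transport u v E : nblk (incid inc' (g u) (g v)) (h @: E) = nblk (incid inc u v) E.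
Proof. by apply: (nblk_transport h_inj g_inj) => f; apply: incid_transport. Qed.

Lemma imset_set2 (x y : T) : g @: [set x; y] = [set g x; g y].
Proof. by rewrite imsetU !imset_set1. Qed.

Lemma imset_eq_set2 (A : {set T}) x' y' : g @: A = [set x'; y'] ->
  exists x y, [/\ x' = g x, y' = g y & A = [set x; y]].
Proof.
move=> e; have /imsetP[x xA ex] : x' \in g @: A by rewrite e set21.
have /imsetP[y yA ey] : y' \in g @: A by rewrite e set22.
exists x, y; split=> //; apply: (imset_inj g_inj).
by rewrite e ex ey imset_set2.
Qed.

Lemma imset_setD1 E f : h @: E :\ h f = h @: (E :\ f).
Proof.
apply/setP=> y; rewrite !inE; apply/andP/imsetP => [[yf /imsetP[k kE ey]]|[k]].
  by exists k => //; rewrite !inE kE andbT; apply: contra yf => /eqP <-; rewrite ey.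
by rewrite !inE => /andP[kf kE ->]; rewrite (inj_eq h_inj) kf imset_f.
Qed.

Lemma PhiE_transport E : PhiE inc' (h @: E) <-> PhiE inc E.
Proof.
split=> -[H1 H2 H3 H4 H5]; split.
- by rewrite -(conn2_transport h_inj g_inj inc_hg).
- by rewrite -(card_imset _ g_inj) -(vset_transport inc_hg).
- move=> e eE; rewrite -(conn2_transport h_inj g_inj inc_hg) -imset_setD1.
  exact/H3/imset_f.
- move=> e u v eE ee; rewrite -nblk_incid_transport -imset_setD1; apply: H4; first exact: imset_f.
  by rewrite inc_hg ee imset_set2.
- move=> X Y u v eXY dXY X1 Y1 uv iXY.
  rewrite -nblk_incid_transport -!(nblk_transport h_inj g_inj inc_hg); apply: H5.
  + by rewrite -imsetU eXY.
  + by rewrite disjoint_imset.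
  + by rewrite card_imset.
  + by rewrite card_imset.
  + by rewrite (inj_eq g_inj).
  rewrite !(vset_transport inc_hg) -imsetI ?iXY ?imset_set2 // => x y _ _; exact: g_inj.
- by rewrite (conn2_transport h_inj g_inj inc_hg).
- by rewrite (vset_transport inc_hg) (card_imset _ g_inj).
- move=> _ /imsetP[e eE ->]; rewrite imset_setD1 (conn2_transport h_inj g_inj inc_hg).
  exact/H3.
- move=> _ u' v' /imsetP[e eE ->]; rewrite inc_hg => /imset_eq_set2[u [v [-> -> ee]]].
  by rewrite imset_setD1 nblk_incid_transport; apply: H4.
move=> X' Y' u' v' /(imset_part h_inj)[X [Y [-> -> eXY]]].
rewrite (disjoint_imset h_inj) !(card_imset _ h_inj) !(vset_transport inc_hg) -imsetI => [|x y _ _]; last exact: g_inj.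
move=> dXY X1 Y1 uv /imset_eq_set2[u [v [eu ev iXY]]].
rewrite eu ev nblk_incid_transport !(nblk_transport h_inj g_inj inc_hg).
by apply: H5 => //; apply: contra uv; rewrite eu ev => /eqP->.
Qed.

End PhiTransport.

(** * Two-vertex cuts *)

Section Cuts.
Variables (T F : finType) (inc : F -> {set T}).
Implicit Types (X Y Z E A B P Q R : {set F}) (S : {set T}) (u v x y z a b t : T).
Local Notation vset := (vset inc).

(* u and v are joined by a path in P, in terms of vertex cuts. *)
Definition linked P u v := forall S, u \in S -> v \notin S ->
  [exists f in P, ~~ [disjoint inc f & S] && ~~ (inc f \subset S)].

Lemma crossP f S : reflect
  ((exists2 t, t \in inc f & t \in S) /\ (exists2 t, t \in inc f & t \notin S))
  (~~ [disjoint inc f & S] && ~~ (inc f \subset S)).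
Proof.
apply: (iffP andP) => -[H1 H2]; split.
- by case/pred0Pn: H1 => t /= /andP[]; exists t.
- by case/subsetPn: H2 => t; exists t.
- by case: H1 => t t1 t2; apply/pred0Pn; exists t; rewrite /= t1.
by case: H2 => t t1 t2; apply/subsetPn; exists t.
Qed.

Lemma disjointU2 X Y R : [disjoint X & Y] -> [disjoint X & R] -> [disjoint X & Y :|: R].
Proof. by rewrite -!setI_eq0 setIUr => /eqP-> /eqP->; rewrite setU0. Qed.

Lemma conn2_two X Y : conn2 inc (X :|: Y) -> X != set0 -> Y != set0 -> [disjoint X & Y] ->
  exists y z, [/\ y != z, y \in vset X, z \in vset X, y \in vset Y & z \in vset Y].
Proof.
move=> cE X0 Y0 d; case/card_gt1P: (conn2_cut cE X0 Y0 d) => y [z []].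
by rewrite !inE => /andP[? ?] /andP[? ?] ?; exists y, z; split.
Qed.

Lemma set2_eq S u v : S \subset [set u; v] -> 1 < #|S| -> S = [set u; v].
Proof.
move=> sS S1; apply/eqP; rewrite eqEcard sS (leq_trans _ S1) // cards2.
by case: eqP.
Qed.

Lemma vset_neq0 t X : t \in vset X -> X != set0.
Proof. by apply: contraTneq => ->; rewrite vset0 inE. Qed.

Lemma set2_other y z u v : y != z -> y \in [set u; v] -> z \in [set u; v] ->
  (u == y) || (u == z).
Proof.
rewrite !inE => yz /orP[] /eqP ey; subst y; rewrite ?eqxx // => /orP[] /eqP ez; subst z.
  by rewrite eqxx orbT.
by rewrite eqxx in yz.
Qed.

(** If no edge of [P] crosses [S], the edges of [P] inside [S] and those outside share no vertex.
    Each of the two sets must meet the rest of [P :|: R] in two vertices, hence in both [v1] and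
    [v2], so they share [v1] after all. *)
Lemma linked_part P R u v v1 v2 : conn2 inc (P :|: R) -> [disjoint P & R] ->
  vset P :&: vset R \subset [set v1; v2] -> u \in vset P -> v \in vset P -> linked P u v.
Proof.
move=> cE dPR sPR uP vP S uS vS; apply: contraT => /exists_inP nc; exfalso.
pose X := [set f in P | inc f \subset S]; pose Y := P :\: X.
have sX : X \subset P by apply/subsetP=> f; rewrite inE => /andP[].
have eXY : X :|: Y = P by apply: setUD_sub.
have dXY : [disjoint X & Y] by apply: disjointD.
have XS t : t \in vset X -> t \in S by case/vsetP=> f; rewrite inE => /andP[_ /subsetP]; apply.
have YS t : t \in vset Y -> t \notin S.
  case/vsetP=> f; rewrite !inE; case: (boolP (f \in P)) => // fP; rewrite andbT /= => fS tf.
  by apply/negP=> tS; apply: nc; exists f => //; rewrite fS andbT; apply/pred0Pn; exists t; apply/andP.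
have nXY t : t \in vset X -> t \in vset Y -> False by move=> /XS tS /YS; rewrite tS.
have uX : u \in vset X.
  by move: uP; rewrite -eXY vsetU inE => /orP[//|/YS]; rewrite uS.
have vY : v \in vset Y.
  by move: vP; rewrite -eXY vsetU inE => /orP[/XS|//]; rewrite (negPf vS).
have X0 := vset_neq0 uX; have Y0 := vset_neq0 vY.
have aux X' Y' : X' :|: Y' = P -> [disjoint X' & Y'] -> X' != set0 -> Y' != set0 ->
    (forall t, t \in vset X' -> t \in vset Y' -> False) -> v1 \in vset X'.
  move=> e d X'0 Y'0 H.
  have sX' : X' \subset P by rewrite -e subsetUl.
  have [||||y [z [yz yX zX]]] := @conn2_two X' (Y' :|: R).
  - by rewrite setUA e.
  - exact: X'0.
  - by apply: contra Y'0; rewrite setU_eq0 => /andP[].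
  - by apply: disjointU2 => //; apply: disjointWl dPR.
  have sub t : t \in vset X' -> t \in vset (Y' :|: R) -> t \in [set v1; v2].
    move=> tX; rewrite vsetU inE => /orP[/(H _ tX)//|tR].
    by apply: (subsetP sPR); rewrite inE tR andbT; apply: subsetP tX; apply: vsetS.
  by move=> /(sub _ yX) y12 /(sub _ zX) z12; case/orP: (set2_other yz y12 z12) => /eqP->.
apply: (nXY v1); first exact: (aux X Y).
by apply: (aux Y X) => //; [rewrite setUC|rewrite disjoint_sym|move=> t tY tX; apply: nXY tY].
Qed.

Lemma conn2_linked Q u v : conn2 inc Q -> u \in vset Q -> v \in vset Q -> linked Q u v.
Proof.
move=> cQ; apply: (@linked_part Q set0 u v u u); rewrite ?setU0 // ?vset0 ?setI0 ?sub0set //.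
by rewrite -setI_eq0 setI0.
Qed.

Lemma idpt_in u v a : a \in [set u; v] -> idpt u v a = u.
Proof. by rewrite !inE => /orP[] /eqP->; rewrite ?idptL ?idptR. Qed.

Lemma idpt_eqL u v t : idpt u v t = u -> t \in [set u; v].
Proof.
by rewrite /idpt !inE; case: (eqVneq t v) => [|_ ->]; rewrite ?orbT ?eqxx.
Qed.

(* The identified vertex is the only possible cut vertex of (X U Y)/uv, since a
   cut elsewhere would already cut X U Y U R. *)
Lemma incid_split X Y R u v : conn2 inc (X :|: Y :|: R) -> X != set0 -> Y != set0 ->
  [disjoint X & Y] -> [disjoint X :|: Y & R] -> vset (X :|: Y) :&: vset R = [set u; v] ->
  cut_le1 (incid inc u v) X Y -> vset X :&: vset (Y :|: R) = [set u; v].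
Proof.
move=> cE X0 Y0 dXY dR bd sm.
have bdP t : t \in vset (X :|: Y) -> t \in vset R -> t \in [set u; v].
  by move=> tX tR; rewrite -bd inE tX.
have sh y z : y \in vset X -> y \in vset Y -> z \in vset X -> z \in vset Y -> idpt u v y = idpt u v z.
  by move=> *; apply: sm; rewrite vset_identify imset_f.
(* [X'] has two attachments to the rest. One in [R] lies in the boundary; if both are in [Y'], the
   identification merges them, so they are [u] and [v]. *)
have aux X' Y' : X' :|: Y' = X :|: Y -> [disjoint X' & Y'] -> X' != set0 -> Y' != set0 ->
   (forall y z, y \in vset X' -> y \in vset Y' -> z \in vset X' -> z \in vset Y' -> idpt u v y = idpt u v z) ->
   exists2 a, a \in [set u; v] & a \in vset X'.
  move=> e d X'0 Y'0 H.
  have sX' : X' \subset X :|: Y by rewrite -e subsetUl.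
  have [||||y [z [yz yX zX]]] := @conn2_two X' (Y' :|: R).
  - by rewrite setUA e.
  - exact: X'0.
  - by apply: contra Y'0; rewrite setU_eq0 => /andP[].
  - by apply: disjointU2 => //; apply: disjointWl dR.
  rewrite vsetU !inE => /orP[yY|yR]; last first.
    by exists y => //; apply: bdP yR; apply: subsetP yX; apply: vsetS.
  move=> /orP[zY|zR]; last first.
    by exists z => //; apply: bdP zR; apply: subsetP zX; apply: vsetS.
  by exists y => //; case/andP: (idpt_eq (H _ _ yX yY zX zY) yz).
have [a auv aX] := aux X Y erefl dXY X0 Y0 sh.
have [b buv bY] : exists2 b, b \in [set u; v] & b \in vset Y.
  apply: (aux Y X) => //; rewrite 1?(setUC Y) 1?disjoint_sym //.
  by move=> y z yY yX zY zX; apply: sh.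
(* Both sides contain [u] or [v], so the merged vertex is the one they share; any common vertex of
   [X] and [Y] is therefore [u] or [v]. *)
apply: set2_eq.
  apply/subsetP=> t; rewrite inE vsetU => /andP[tX]; rewrite inE => /orP[tY|].
    apply: idpt_eqL; have := sm (idpt u v t) u; apply; rewrite vset_identify.
    - exact: imset_f.
    - exact: imset_f.
    - by apply/imsetP; exists a; rewrite ?idpt_in.
    by apply/imsetP; exists b; rewrite ?idpt_in.
  by apply: bdP; rewrite vsetU inE tX.
apply: conn2_cut => //; first by rewrite setUA.
  by apply: contra Y0; rewrite setU_eq0 => /andP[].
by apply: disjointU2 => //; apply: disjointWl dR; apply: subsetUl.
Qed.

(** Each of [X] and [Y] has two attachments to the rest, at most one of them common to both; another
    must be an end [u] or [v] missing from the other part. Which part holds which end is not known,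
    hence the names [a] and [b]. Since [b] is not in [X], the attachments of [X] cannot both be
    ends, and this yields [x]. *)
Lemma chain_split X Y R u v : conn2 inc (X :|: Y :|: R) -> X != set0 -> Y != set0 ->
  [disjoint X & Y] -> [disjoint X :|: Y & R] -> vset (X :|: Y) :&: vset R = [set u; v] ->
  cut_le1 inc X Y -> exists a b x,
  [/\ [set a; b] = [set u; v], a \in vset X /\ a \notin vset Y, b \in vset Y /\ b \notin vset X,
      x != a /\ x != b & vset X :&: vset Y = [set x]].
Proof.
move=> cE X0 Y0 dXY dR bd sm.
have bdP t : t \in vset (X :|: Y) -> t \in vset R -> t \in [set u; v].
  by move=> tX tR; rewrite -bd inE tX.
have two X' Y' : X' :|: Y' = X :|: Y -> [disjoint X' & Y'] -> X' != set0 -> Y' != set0 ->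
   exists y z, [/\ y != z, y \in vset X', z \in vset X', y \in vset Y' \/ y \in [set u; v] & z \in vset Y' \/ z \in [set u; v]].
  move=> e d X'0 Y'0.
  have sX' : X' \subset X :|: Y by rewrite -e subsetUl.
  have [||||y [z [yz yX zX yYR zYR]]] := @conn2_two X' (Y' :|: R).
  - by rewrite setUA e.
  - exact: X'0.
  - by apply: contra Y'0; rewrite setU_eq0 => /andP[].
  - by apply: disjointU2 => //; apply: disjointWl dR.
  have sub t : t \in vset X' -> t \in vset (Y' :|: R) -> t \in vset Y' \/ t \in [set u; v].
    move=> tX; rewrite vsetU inE => /orP[|tR]; [by left|right].
    by apply: bdP tR; apply: subsetP tX; apply: vsetS.
  by exists y, z; split=> //; apply: sub.
have aux X' Y' : X' :|: Y' = X :|: Y -> [disjoint X' & Y'] -> X' != set0 -> Y' != set0 ->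
   cut_le1 inc X' Y' -> exists2 a, a \in [set u; v] & (a \in vset X') && (a \notin vset Y').
  move=> e d X'0 Y'0 sm'; have [y [z [yz yX zX yY zY]]] := two X' Y' e d X'0 Y'0.
  case: (boolP (y \in vset Y')) => yY'; last by case: yY => [yY|yuv]; [rewrite yY in yY'|exists y; rewrite ?yX].
  case: (boolP (z \in vset Y')) => zY'; last by case: zY => [zY|zuv]; [rewrite zY in zY'|exists z; rewrite ?zX].
  by rewrite (sm' y z) ?eqxx in yz.
have [a auv /andP[aX aY]] := aux X Y erefl dXY X0 Y0 sm.
have [b buv /andP[bY bX]] : exists2 b, b \in [set u; v] & (b \in vset Y) && (b \notin vset X).
  apply: (aux Y X) => //; rewrite 1?(setUC Y) 1?disjoint_sym //.
  exact: cut_le1_sym.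
have ab : a != b by apply: contraNneq bX => <-.
have eab : [set a; b] = [set u; v].
  apply: set2_eq; last by rewrite cards2 ab.
  by apply/subsetP=> t; rewrite !inE => /orP[] /eqP->; rewrite -in_set2.
have [y [z [yz yX zX]]] := two X Y erefl dXY X0 Y0; rewrite -eab => yY zY.
have [x [xX xY]] : exists x, x \in vset X /\ x \in vset Y.
  case: yY => [yY|yab]; first by exists y.
  case: zY => [zY|zab]; first by exists z.
  move: yab zab; rewrite !(setUC [set a]) => yab zab.
  by case/orP: (set2_other yz yab zab) => /eqP eb; move: bX; rewrite eb ?yX ?zX.
exists a, b, x; split=> //.
  by split; [apply: contraNneq aY => <-|apply: contraNneq bX => <-].
apply/setP=> t; rewrite !inE; apply/andP/eqP => [[tX tY]|->//].
by apply: sm.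
Qed.

(** The sides of a cut are interchangeable, so a chosen edge may be placed in the first. *)
Lemma conn2I_at f E : f \in E ->
  (forall X Y, X :|: Y = E -> [disjoint X & Y] -> f \in X -> Y != set0 -> cut_le1 inc X Y -> False) ->
  conn2 inc E.
Proof.
move=> fE H; apply: conn2I => [|X Y eXY dXY X0 Y0 sm]; first by apply/set0Pn; exists f.
move: (fE); rewrite -eXY inE => /orP[fX|fY]; first exact: (H X Y).
by apply: (H Y X) => //; [rewrite setUC|rewrite disjoint_sym|apply: cut_le1_sym].
Qed.

Lemma conn2_split_at f E : f \in E -> ~~ conn2 inc E -> exists X Y,
  [/\ X :|: Y = E, [disjoint X & Y], f \in X, Y != set0 & cut_le1 inc X Y].
Proof.
move=> fE nE; have [|X [Y [eXY dXY X0 Y0 sm]]] := conn2_split _ nE; first by apply/set0Pn; exists f.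
move: (fE); rewrite -eXY inE => /orP[fX|fY]; first by exists X, Y.
by exists Y, X; split=> //; [rewrite setUC|rewrite disjoint_sym|apply: cut_le1_sym].
Qed.

(* Both parts of a cut of (X U Y)/uv would contain u and v, hence have edges in
   both X and Y, and so would meet in the vertex shared by X and Y. *)
Lemma necklace X Y R u v : conn2 inc (X :|: Y :|: R) -> X != set0 -> Y != set0 ->
  [disjoint X & Y] -> [disjoint X :|: Y & R] -> vset (X :|: Y) :&: vset R = [set u; v] ->
  cut_le1 inc X Y -> conn2 (incid inc u v) (X :|: Y).
Proof.
move=> cE X0 Y0 dXY dR bd sm.
have [a [b [x [eab [aX aY] [bY bX] [xa xb] ix]]]] := chain_split cE X0 Y0 dXY dR bd sm.
have sX : vset X \subset vset (X :|: Y) by apply: vsetS; apply: subsetUl.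
apply: conn2I => [|X' Y' e d X'0 Y'0 sm'].
  by apply: contra X0; rewrite setU_eq0 => /andP[].
(* An edge of [Z] at [a] lies in [X], so [X :&: Z] is nonempty; it meets the remaining edges only
   within [x] and [a]. Since 2-connectedness asks for two such vertices, [x] is one of them. *)
have key Z Z' : Z :|: Z' = X :|: Y -> [disjoint Z & Z'] -> vset Z :&: vset (Z' :|: R) = [set u; v] -> x \in vset Z.
  move=> eZ dZ; rewrite -eab => bZ; pose W := X :&: Z.
  pose E := X :|: Y :|: R.
  have sW : W \subset E by rewrite /W /E -setUA subIset // subsetUl.
  have [||||y [z [yz yW zW yE zE]]] := @conn2_two W (E :\: W).
  - by rewrite setUD_sub.
  - have : a \in vset Z :&: vset (Z' :|: R) by rewrite bZ set21.
    rewrite inE => /andP[/vsetP[f fZ af] _]; apply/set0Pn; exists f; rewrite inE fZ andbT.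
    have : f \in X :|: Y by rewrite -eZ inE fZ.
    by rewrite inE => /orP[//|fY]; rewrite (mem_vset fY af) in aY.
  - case/set0Pn: Y0 => f fY; apply/set0Pn; exists f; rewrite !inE fY orbT andbT.
    by move: dXY; rewrite -setI_eq0 => /eqP/setP/(_ f); rewrite !inE fY andbT => ->.
  - exact: disjointD.
  have tuv t : t \in vset X -> t \in vset Z -> t \in vset (Z' :|: R) -> t \in [set x; a].
    move=> tX tZ tR; have : t \in [set a; b] by rewrite -bZ inE tZ.
    rewrite !inE => /orP[->|/eqP e']; first by rewrite orbT.
    by rewrite e' (negPf bX) in tX.
  have sub t : t \in vset W -> t \in vset (E :\: W) -> t \in [set x; a].
    move=> tW; have tX : t \in vset X by apply: subsetP tW; apply: vsetS; apply: subsetIl.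
    have tZ : t \in vset Z by apply: subsetP tW; apply: vsetS; apply: subsetIr.
    case/vsetP=> g /setDP[/setUP[/setUP[gX|gY]|gR] gW] tg.
    - apply: tuv => //; apply: mem_vset tg; move: gW; rewrite inE gX /= => gZ.
      have : g \in Z :|: Z' by rewrite eZ inE gX.
      by rewrite !inE (negPf gZ) => /= ->.
    - have : t \in vset X :&: vset Y by rewrite inE tX (mem_vset gY tg).
      by rewrite ix => /set1P->; rewrite set21.
    by apply: tuv => //; apply: mem_vset tg; rewrite inE gR orbT.
  have : x \in vset W by case/orP: (set2_other yz (sub y yW yE) (sub z zW zE)) => /eqP->.
  by apply: subsetP; apply: vsetS; apply: subsetIr.
have xX' : x \in vset X'.
  by apply: (key X' Y') => //; apply: incid_split; rewrite ?e.
have xY' : x \in vset Y'.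
  have e' : Y' :|: X' = X :|: Y by rewrite setUC.
  have d' : [disjoint Y' & X'] by rewrite disjoint_sym.
  by apply: (key Y' X') => //; apply: incid_split; rewrite ?e' //; apply: cut_le1_sym.
have : x \in vset X' :&: vset (Y' :|: R) by rewrite inE xX' vsetU inE xY'.
have -> : vset X' :&: vset (Y' :|: R) = [set u; v] by apply: incid_split; rewrite ?e.
by rewrite -eab !inE (negPf xa) (negPf xb).
Qed.

End Cuts.

Section ConnIdentify.
Variables (T F : finType) (inc : F -> {set T}).

(** Pull [S] back along the identification. An edge of [P] missing from [P'] has its ends among [x]
    and [y], so it has become a loop and crosses nothing. *)
Lemma linked_incid (P P' : {set F}) (u v x y : T) : linked inc P u v ->
  {in P, forall f, f \in P' \/ inc f \subset [set x; y]} ->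
  linked (incid inc x y) P' (idpt x y u) (idpt x y v).
Proof.
move=> cP H S uS vS.
have [||f fP /crossP[[t tf tS] [t' tf' tS']]] := exists_inP (cP (idpt x y @^-1: S) _ _).
- by rewrite inE.
- by rewrite inE.
rewrite !inE in tS tS'; apply/exists_inP; exists f; last first.
  apply/crossP; split; first by exists (idpt x y t); rewrite ?imset_f.
  by exists (idpt x y t'); rewrite ?imset_f.
case: (H f fP) => // /subsetP sf; move: tS tS'.
by rewrite !idpt_in ?sf // => ->.
Qed.

End ConnIdentify.

(** * Replacing an edge by the gadget *)

Section Gadget.
Variables (T F : finType) (inc : F -> {set T}) (e : F) (A B : {set F}) (w u v : T).
Hypothesis ince : inc e = [set u; v].
Hypothesis incA : {in A, forall f, inc f = [set w; u]}.
Hypothesis incB : {in B, forall f, inc f = [set w; v]}.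
Hypothesis wu : w != u.
Hypothesis wv : w != v.
Hypothesis A0 : A != set0.
Hypothesis B0 : B != set0.
Hypothesis dAB : [disjoint A & B].
Implicit Types (P X Y : {set F}).
Local Notation vset := (vset inc).

(** The classes are only assumed nonempty, and [u = v] is allowed: the former serves when an edge of
    the gadget is deleted, the latter when an identification merges the ends of [e]. *)
Let Gad P := A :|: B :|: P.

Lemma vset_gadget P : vset (Gad P) = w |: vset (e |: P).
Proof.
rewrite /Gad !vsetU (vset_parallel A0 incA) (vset_parallel B0 incB) vset1 ince.
by apply/setP=> t; rewrite !inE; case: (t == w); case: (t == u); case: (t == v).
Qed.

Section OneGadget.
Variable P : {set F}.
Hypothesis eP : e \notin P.
Hypothesis dP : [disjoint A :|: B & P].
Hypothesis wP : w \notin vset P.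

(** In a cut of [e |: P], put the gadget in place of [e] on its side. The only new vertex is [w],
    which lies outside [P], so no further vertex becomes shared. *)
Lemma gadget_conn2_conv : conn2 inc (Gad P) -> conn2 inc (e |: P).
Proof.
move=> cG; apply: (@conn2I_at _ _ _ e) => [|X Y eXY dXY eX Y0 sm]; first exact: setU11.
have eY : e \notin Y by move: dXY; rewrite disjoint_sym => /disjointFl->.
have sY : Y \subset P.
  apply/subsetP=> f fY; have : f \in e |: P by rewrite -eXY inE fY orbT.
  by case/setU1P=> // ef; rewrite ef (negPf eY) in fY.
have sX : X :\ e \subset P.
  apply/subsetP=> f; rewrite !inE => /andP[fe fX].
  by have : f \in e |: P by [rewrite -eXY inE fX]; rewrite !inE (negPf fe).
apply: (@conn2_not_cut_le1 _ _ inc (Gad (X :\ e)) Y) => //.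
- rewrite /Gad -setUA; congr conn2: cG; congr (_ :|: _).
  apply/setP=> f; move/setP/(_ f): eXY; rewrite !inE; case: (eqVneq f e) => [->|_] //=.
  by rewrite (negPf eP) (negPf eY).
- by apply: contra A0; rewrite !setU_eq0 -andbA => /andP[].
- rewrite /Gad disjoint_sym; apply: disjointU2; rewrite disjoint_sym.
    by apply: disjointWr dP.
  by apply: disjointWl dXY; apply: subsetDl.
rewrite /cut_le1 vset_gadget setD1K // => y z.
have sub t : t \in w |: vset X -> t \in vset Y -> t \in vset X.
  case/setU1P => [->|//] wY; case/negP: wP.
  by apply: subsetP wY; apply: vsetS.
by move=> /sub yX yY /sub zX zY; apply: sm; rewrite ?yX ?zX.
Qed.

(** The side condition excludes the bridge: for [u != v] and [P] empty, the gadget is cut at [w],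
    whereas [e] alone is 2-connected. *)
Lemma gadget_conn2 : conn2 inc (e |: P) -> (u == v) || (P != set0) -> conn2 inc (Gad P).
Proof.
move=> cE uvP; have [a aA] := set0Pn _ A0; have [b bB] := set0Pn _ B0.
apply: (@conn2I_at _ _ _ a) => [|X Y eXY dXY aX Y0 sm]; first by rewrite !inE aA.
have Xw : w \in vset X by apply: mem_vset aX _; rewrite incA ?set21.
have Xu : u \in vset X by apply: mem_vset aX _; rewrite incA ?set22.
have nXY f : f \in X -> f \in Y -> False by move=> fX; rewrite (disjointFr dXY fX).
have AX f : f \in A -> f \in X.
  move=> fA; have : f \in X :|: Y by rewrite eXY !inE fA.
  case/setUP=> // fY; case/eqP: wu; apply: sm => //; apply: mem_vset fY _; by rewrite incA ?inE ?eqxx ?orbT.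
have sP Z : e \notin Z :&: P by rewrite inE negb_and eP orbT.
have PXY : P = (X :&: P) :|: (Y :&: P).
  rewrite -setIUl eXY; apply/esym/setIidPr; exact: subsetUr.
have vI Z t : t \in vset (Z :&: P) -> t \in vset Z /\ t != w.
  move=> tZ; split; first by apply: subsetP tZ; apply: vsetS; apply: subsetIl.
  apply: contraNneq wP => <-; apply: subsetP tZ; apply: vsetS; exact: subsetIr.
have dZ (Z Z' : {set F}) : [disjoint Z & Z'] -> [disjoint e |: (Z :&: P) & (Z' :&: P)].
  move=> d; rewrite disjoint_sym; apply: disjointU2; first by rewrite disjoint_sym disjoints1.
  rewrite disjoint_sym; apply: disjointWl (subsetIl _ _) _; apply: disjointWr d; exact: subsetIl.
have e0 (Z : {set F}) : e |: Z != set0 by apply/set0Pn; exists e; rewrite setU11.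
have YP f : f \in Y -> f \notin B -> f \in P.
  move=> fY fB; have : f \in Gad P by rewrite -eXY inE fY orbT.
  rewrite !inE (negPf fB) orbF => /orP[/AX fX|//]; by case: (nXY f).
have : b \in X :|: Y by rewrite eXY !inE bB orbT.
(* If both classes lie in [X], then putting [e] in their place gives a cut of [e |: P]. Otherwise
   the cut runs through [w]. *)
case/setUP=> [bX|bY].
  have Xv : v \in vset X by apply: mem_vset bX _; rewrite incB ?set22.
  have BX f : f \in B -> f \notin Y.
    move=> fB; apply/negP=> fY; case/eqP: wv; apply: sm => //; apply: mem_vset fY _; by rewrite incB ?inE ?eqxx ?orbT.
  have YsP : Y = Y :&: P.
    apply/esym/setIidPl/subsetP=> f fY; apply: YP => //; apply/negP=> /BX; by rewrite fY.
  apply: (@conn2_not_cut_le1 _ _ inc (e |: (X :&: P)) Y) => //.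
    by rewrite YsP -setUA -PXY.
    by rewrite YsP dZ.
  have sub t : t \in vset (e |: X :&: P) -> t \in vset X.
    by rewrite vsetU vset1 ince !inE -orbA => /or3P[/eqP->|/eqP->|/vI[]].
  by move=> y z /sub yX yY /sub zX zY; apply: sm.
have Yw : w \in vset Y by apply: mem_vset bY _; rewrite incB ?set21.
have Yv : v \in vset Y by apply: mem_vset bY _; rewrite incB ?set22.
have P0 : P != set0.
  by case/orP: uvP => // /eqP euv; case/eqP: wu; apply: sm => //; rewrite euv.
have BY f : f \in B -> f \notin X.
  move=> fB; apply/negP=> fX; case/eqP: wv; apply: sm => //; apply: mem_vset fX _; by rewrite incB ?inE ?eqxx ?orbT.
have onlyw t : t \in vset X -> t \in vset Y -> t = w by move=> tX tY; apply: sm.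
(* [w] is the only shared vertex and is not in [P], so the two pieces of [P] have no common vertex.
   Adding [e] to one piece makes it meet the other, chosen nonempty, in a single end of [e]. *)
move: P0; rewrite PXY setU_eq0 negb_and => /orP[X0|Y1].
  apply: (@conn2_not_cut_le1 _ _ inc (e |: (Y :&: P)) (X :&: P)); rewrite -?setUA -1?(setUC (X :&: P)) -?PXY //.
    by apply: dZ; rewrite disjoint_sym.
  have sub t : t \in vset (e |: Y :&: P) -> t \in vset (X :&: P) -> t = u.
    rewrite vsetU vset1 ince !inE -orbA => /or3P[/eqP-> //|/eqP->|/vI[tY tw]] /vI[tX tw'].
      by case/eqP: tw'; apply: onlyw.
    by case/eqP: tw; apply: onlyw.
  by move=> y z yX yY zX zY; rewrite (sub y yX yY) (sub z zX zY).
apply: (@conn2_not_cut_le1 _ _ inc (e |: (X :&: P)) (Y :&: P)); rewrite -?setUA -?PXY //.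
  exact: dZ.
have sub t : t \in vset (e |: X :&: P) -> t \in vset (Y :&: P) -> t = v.
  rewrite vsetU vset1 ince !inE -orbA => /or3P[/eqP->|/eqP-> //|/vI[tX tw]] /vI[tY tw'].
    by case/eqP: tw'; apply: onlyw.
  by case/eqP: tw; apply: onlyw.
by move=> y z yX yY zX zY; rewrite (sub y yX yY) (sub z zX zY).
Qed.

End OneGadget.

(** A path between [u] and [v] that enters [Y] must leave it through the same vertex, so the detour
    can be omitted. *)
Lemma linked_cut X Y : cut_le1 inc (e |: X) Y -> linked inc (X :|: Y) u v -> linked inc X u v.
Proof.
move=> sm cP S uS vS.
have uX : u \in vset (e |: X) by rewrite vsetU vset1 ince !inE eqxx.
have vX : v \in vset (e |: X) by rewrite vsetU vset1 ince !inE eqxx orbT.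
(* All vertices of [Y] are put on the side of the vertex shared with [e |: X], so no edge of [Y]
   crosses [S']. *)
pose S' := [set t | if t \in vset Y then [exists z, [&& z \in vset (e |: X), z \in vset Y & z \in S]] else t \in S].
have shared t : t \in vset (e |: X) -> (t \in S') = (t \in S).
  move=> tX; rewrite inE; case: ifP => // tY; apply/existsP/idP => [[z /and3P[zX zY zS]]|tS].
    by rewrite (sm t z).
  by exists t; rewrite tX tY.
have [||f /setUP[fX|fY] /crossP[[t tf tS] [t' tf' tS']]] := exists_inP (cP S' _ _); rewrite ?shared //.
  apply/exists_inP; exists f => //; apply/crossP.
  have sub s : s \in inc f -> s \in vset (e |: X) by move=> sf; apply: mem_vset sf; rewrite inE fX orbT.
  by split; [exists t|exists t'] => //; rewrite -shared // sub.
by move: tS tS'; rewrite !inE (mem_vset fY tf) (mem_vset fY tf') => ->.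
Qed.

(** Induction on the size of [P]: a cut of [e |: P] splits off a set [Y] without [e], and the same
    [Y] splits off from [Gad P]. The link between [u] and [v] survives by [linked_cut], so the
    process ends with two 2-connected sets and never with a bridge. *)
Lemma gadget_nblk P : e \notin P -> [disjoint A :|: B & P] -> w \notin vset P ->
  linked inc P u v -> nblk inc (Gad P) = nblk inc (e |: P).
Proof.
move: {2}#|P|.+1 (ltnSn #|P|) => n; elim: n P => // n IH P cP eP dP wP cn.
have [cE|nE] := boolP (conn2 inc (e |: P)).
  rewrite (nblk_conn2 cE) nblk_conn2 // gadget_conn2 //.
  case: eqP => //= /eqP uv; apply/negP=> /eqP P0.
  (* With [P] empty, no edge crosses [[set u]], against the link. *)
  by have := cn [set u]; rewrite inE eqxx inE eq_sym uv P0 => /(_ isT isT)/exists_inP[f]; rewrite inE.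
have [X [Y [eXY dXY eX Y0 sm]]] := conn2_split_at (setU11 _ _) nE.
have eY : e \notin Y by rewrite (disjointFr dXY eX).
have sY : Y \subset P.
  apply/subsetP=> f fY; have : f \in e |: P by rewrite -eXY inE fY orbT.
  by case/setU1P=> // ef; rewrite ef (negPf eY) in fY.
have PXY : P = X :\ e :|: Y.
  apply/setP=> f; move/setP/(_ f): eXY; rewrite !inE; case: (eqVneq f e) => [->|_] //=.
  by rewrite (negPf eP) (negPf eY).
have sX : X :\ e \subset P by rewrite PXY subsetUl.
have wX : w \notin vset (X :\ e) by apply: contra wP; apply: subsetP; apply: vsetS.
have wY : w \notin vset Y by apply: contra wP; apply: subsetP; apply: vsetS.
rewrite -eXY nblk_split // -[X in nblk _ X + _](setD1K eX) -IH ?setD11 //.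
- rewrite -nblk_split; first by rewrite /Gad -(setUA (A :|: B)) -PXY.
    move=> y z; rewrite vset_gadget setD1K //.
    have sub t : t \in w |: vset X -> t \in vset Y -> t \in vset X.
      by case/setU1P => [->|//] wY'; rewrite wY' in wY.
    by move=> /sub yX yY /sub zX zY; apply: sm; rewrite ?yX ?zX.
  rewrite /Gad disjoint_sym; apply: disjointU2; rewrite disjoint_sym.
    by apply: disjointWr dP.
  by apply: disjointWl dXY; apply: subsetDl.
- rewrite -ltnS; apply: leq_trans cP; rewrite ltnS; apply: proper_card; rewrite properE sX /=.
  have [f fY] := set0Pn _ Y0; apply/subsetPn; exists f; first exact: (subsetP sY).
  by rewrite inE negb_and (disjointFl dXY fY) orbT.
- by apply: disjointWr dP.
by apply: (@linked_cut _ Y); rewrite ?setD1K // -PXY.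
Qed.

End Gadget.

(** * Finding a gadget *)

Section Structure.
Variables (T F : finType) (inc : F -> {set T}) (E : {set F}).
Hypothesis inc_ends : forall f, exists u v, inc f = [set u; v].
Hypothesis phiE : PhiE inc E.
Implicit Types (P X Y Z R : {set F}) (u v x a b t : T).
Local Notation vset := (vset inc).

Lemma card_inc_le2 f : #|inc f| <= 2.
Proof. by have [u [v ->]] := inc_ends f; rewrite cards2; case: eqP. Qed.

(** An edge must share two vertices with the other edges, so it is no loop; if there are no others,
    it covers at least two vertices by itself. *)
Lemma card_inc_gt1 f : f \in E -> 1 < #|inc f|.
Proof.
case: phiE => cE V1 _ _ _ fE; case: (eqVneq (E :\ f) set0) => [E0|E0].
  by rewrite -(setD1K fE) E0 setU0 vset1 in V1.
have := @conn2_cut _ _ inc [set f] (E :\ f); rewrite setD1K // vset1 => /(_ cE _ E0 (disjoint1D _ _)).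
have -> : [set f] != set0 by apply/set0Pn; exists f; rewrite set11.
by move=> /(_ isT) H; apply: (leq_trans H); apply: subset_leq_card; apply: subsetIl.
Qed.

Lemma inc_sub_vsetD f : f \in E -> inc f \subset vset (E :\ f).
Proof.
case: phiE => cE _ cD _ _ fE; have E0 := conn2_neq0 (cD f fE).
have := @conn2_cut _ _ inc [set f] (E :\ f); rewrite setD1K // vset1 => /(_ cE _ E0 (disjoint1D _ _)).
have -> : [set f] != set0 by apply/set0Pn; exists f; rewrite set11.
move=> /(_ isT) H; have /eqP <- : inc f :&: vset (E :\ f) == inc f by rewrite eqEcard subsetIl (leq_trans (card_inc_le2 f)).
exact: subsetIr.
Qed.

(** (c') with first part [Z]: it is one block, and identifying [x] and [a] turns it into [#|Z|]
    loops, each a block. *)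
Lemma parallel_even Z x a : Z \subset E -> {in Z, forall f, inc f = [set x; a]} -> x != a ->
  1 < #|Z| -> 1 < #|E :\: Z| -> [set x; a] \subset vset (E :\: Z) -> ~~ odd #|Z|.
Proof.
case: phiE => _ _ _ _ H sZ pZ xa Z1 EZ1 sxa.
have /set0Pn[z zZ] : Z != set0 by rewrite -card_gt0 (leq_trans _ Z1).
have vZ : vset Z = [set x; a] by apply: (vset_parallel _ pZ); apply/set0Pn; exists z.
have [|] := H Z (E :\: Z) x a (setUD_sub sZ) (disjointD _ _) Z1 EZ1 xa.
  by rewrite vZ; apply/setIidPl.
rewrite (@nblk_conn2 _ _ inc Z); last first.
  by apply: (conn2_parallel _ pZ); [apply/set0Pn; exists z|rewrite cards2 xa].
by rewrite (@nblk_loops _ _ _ x) => [-> //|f fZ]; rewrite /incid pZ // imsetU !imset_set1 idptL idptR setUid.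
Qed.

(** The complement has the two edges that (c') requires; for [P] itself they follow from the third
    vertex, by [card_vset_gt2]. *)
Definition two_cut P := [&& P \subset E, 1 < #|E :\: P|, #|vset P :&: vset (E :\: P)| == 2 & 2 < #|vset P|].

Lemma card_vset_gt2 X : 2 < #|vset X| -> 1 < #|X|.
Proof.
rewrite !ltnNge; apply: contra; case: (eqVneq X set0) => [->|X0 X1]; first by rewrite vset0 !cards0.
have /cards1P[f ->] : #|X| == 1 by rewrite eqn_leq X1 card_gt0.
by rewrite vset1 card_inc_le2.
Qed.

Lemma two_cut_part X Y u v t : X :|: Y = E -> [disjoint X & Y] -> 1 < #|Y| ->
  vset X :&: vset Y = [set u; v] -> u != v -> t \in vset X -> t \notin [set u; v] -> two_cut X.
Proof.
move=> eXY d Y1 bd uv tX tuv.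
have eY : E :\: X = Y by rewrite -eXY disjoint_setUD.
rewrite /two_cut eY Y1 bd cards2 uv -eXY subsetUl /=.
apply: leq_trans (_ : #|t |: [set u; v]| <= _); first by rewrite cardsU1 tuv cards2 uv.
by apply: subset_leq_card; rewrite subUset sub1set tX -bd subsetIl.
Qed.

Lemma third_vertex (S : {set T}) u v : 2 < #|S| -> exists2 t, t \in S & t \notin [set u; v].
Proof.
move=> S2; apply/subsetPn; apply: contraL S2 => /subset_leq_card H.
by rewrite -leqNgt (leq_trans H) // cards2; case: eqP.
Qed.

Lemma set0_card_gt1 Y (e : F) : Y != set0 -> e \notin Y -> 1 < #|e |: Y|.
Proof. by move=> Y0 eY; rewrite cardsU1 eY ltnS card_gt0. Qed.

(** By (b') the contraction of [e] is not a single block. A cut of it gives, through [incid_split]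
    with [e] as the rest, two parts attached exactly at the ends of [e]; one of them holds a third
    vertex. *)
Lemma two_cut_exists : 2 < #|vset E| -> exists P, two_cut P.
Proof.
case: phiE => cE V1 cD He _ V2.
have /set0Pn[e eE] := conn2_neq0 cE; have [u [v ee]] := inc_ends e.
have uv : u != v by move: (card_inc_gt1 eE); rewrite ee cards2; case: eqP.
have nc : ~~ conn2 (incid inc u v) (E :\ e).
  by apply/negP=> /nblk_conn2 n1; have := He e u v eE ee; rewrite n1.
have [X [Y [eXY d X0 Y0 sm]]] := conn2_split (conn2_neq0 (cD e eE)) nc.
have [t tE tuv] := third_vertex u v V2.
have main X' Y' : X' :|: Y' = E :\ e -> [disjoint X' & Y'] -> X' != set0 -> Y' != set0 ->
    cut_le1 (incid inc u v) X' Y' -> t \in vset X' -> two_cut X'.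
  move=> eXY' d' X'0 Y'0 sm' tX'.
  have eX' : e \notin X' by apply/negP=> eX'; move/setP/(_ e): eXY'; rewrite !inE eX' eqxx.
  have eY' : e \notin Y' by apply/negP=> eY'; move/setP/(_ e): eXY'; rewrite !inE eY' eqxx orbT.
  (* Counting [e] with the other side gives the complement its two edges. *)
  apply: (@two_cut_part X' (Y' :|: [set e]) u v t) => //.
  - by rewrite setUA eXY' setUC setD1K.
  - by apply: disjointU2 => //; rewrite disjoint_sym disjoints1.
  - by rewrite setUC set0_card_gt1.
  apply: incid_split => //.
  - by rewrite eXY' setUC setD1K.
  - by rewrite eXY' disjoint_sym disjoint1D.
  by rewrite eXY' vset1 -ee; apply/setIidPr/inc_sub_vsetD.
have : t \in vset (E :\ e).
  case/vsetP: tE => f fE tf; apply: (mem_vset _ tf); rewrite !inE fE andbT.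
  by apply: contraNneq tuv => fe; rewrite -ee -fe.
rewrite -eXY vsetU => /setUP[tX|tY]; first by exists X; apply: (main X Y).
exists Y; apply: (main Y X) => //; first by rewrite setUC.
  by rewrite disjoint_sym.
exact: cut_le1_sym.
Qed.

(** [X] meets the rest only in [x] and [a], so a third vertex would make it a two-cut smaller than
    the minimal [X :|: Y]. The hypotheses are symmetric, so the lemma treats [Y] as well. *)
Lemma piece_double X Y R a b x : X :|: Y :|: R = E -> [disjoint X & Y] -> [disjoint X :|: Y & R] ->
  1 < #|R| -> vset (X :|: Y) :&: vset R = [set a; b] -> a \in vset X -> a \notin vset Y ->
  b \in vset Y -> b \notin vset X -> x != a -> x != b -> vset X :&: vset Y = [set x] ->
  (forall Z, two_cut Z -> #|X :|: Y| <= #|Z|) ->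
  #|X| = 2 /\ {in X, forall f, inc f = [set x; a]}.
Proof.
move=> eE dXY dR R1 bd aX aY bY bX xa xb ix mn.
have tR t : t \in vset (X :|: Y) -> t \in vset R -> t \in [set a; b] by move=> *; rewrite -bd inE; apply/andP.
have [xX xY] : x \in vset X /\ x \in vset Y by apply/andP; rewrite -in_setI ix set11.
have aR : a \in vset R by have : a \in [set a; b] := set21 _ _; rewrite -bd inE => /andP[].
have dX : [disjoint X & Y :|: R] by apply: disjointU2 => //; apply: disjointWl dR; apply: subsetUl.
have X0 := vset_neq0 aX; have Y0 := vset_neq0 bY.
have bdX : vset X :&: vset (Y :|: R) = [set x; a].
  apply/setP=> t; rewrite vsetU; apply/idP/idP => [|/set2P[]->]; last first.
  - by rewrite !inE aX aR orbT.
  - by rewrite !inE xX xY.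
  case/setIP=> tX /setUP[tY|tR'].
    by have : t \in [set x] by [rewrite -ix inE tX]; move/set1P->; rewrite set21.
  have /set2P[->|tb] : t \in [set a; b] by apply: tR; rewrite ?vsetU ?inE ?tX.
    by rewrite set22.
  by rewrite tb (negPf bX) in tX.
have YR1 : 1 < #|Y :|: R| by apply: (leq_trans R1); apply: subset_leq_card; apply: subsetUr.
have eE' : X :|: (Y :|: R) = E by rewrite setUA.
have vX : vset X = [set x; a].
  apply/esym/eqP; rewrite eqEcard cards2 xa -{1}bdX subsetIl leqNgt /=; apply/negP=> X2.
  have [t tX txa] := third_vertex x a X2.
  have := mn X (two_cut_part eE' dX YR1 bdX xa tX txa); rewrite leqNgt => /negP; apply.
  apply: proper_card; rewrite properE subsetUl /=; have [y yY] := set0Pn _ Y0.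
  by apply/subsetPn; exists y; rewrite ?inE ?yY ?orbT // (disjointFl dXY).
have iX : {in X, forall f, inc f = [set x; a]}.
  move=> f fX; apply: set2_eq; first by rewrite -vX -(vset1 inc) vsetS // sub1set.
  by apply: card_inc_gt1; rewrite -eE' inE fX.
split=> //.
have eD Z : Z \subset X -> Y :|: R \subset E :\: Z.
  move=> sZ; apply/subsetP=> f fYR; rewrite inE -eE' inE fYR orbT andbT.
  by apply/negP=> /(subsetP sZ) fX; rewrite (disjointFr dX fX) in fYR.
have ev Z : Z \subset X -> 1 < #|Z| -> ~~ odd #|Z|.
  move=> sZ Z1; apply: (@parallel_even Z x a) => //.
  - by apply: (subset_trans sZ); rewrite -eE' subsetUl.
  - by move=> f /(subsetP sZ) /iX.
  - by apply: (leq_trans YR1); apply/subset_leq_card/eD.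
  by rewrite -bdX; apply: (subset_trans (subsetIr _ _)); apply/vsetS/eD.
(* If [X] were a single edge, its deletion would leave [Y] and [R] meeting only in [b], against
   (a'). *)
have X1 : 1 < #|X|.
  rewrite ltnNge; apply/negP=> X1; have /cards1P[f eX] : #|X| == 1 by rewrite eqn_leq X1 card_gt0.
  case: phiE => _ _ cD _ _; have fE : f \in E by rewrite -eE' eX !inE eqxx.
  have := cD f fE; rewrite -eE' eX disjoint_setUD -?eX // => cYR.
  apply: (conn2_not_cut_le1 cYR) => //.
  - by rewrite -card_gt0 (leq_trans _ R1).
  - by apply: disjointWl dR; apply: subsetUr.
  have sub t : t \in vset Y -> t \in vset R -> t = b.
    move=> tY tR'; have /set2P[ta|//] : t \in [set a; b] by apply: tR; rewrite ?vsetU ?inE ?tY ?orbT.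
    by rewrite -ta tY in aY.
  by move=> y z yY yR zY zR; rewrite (sub y yY yR) (sub z zY zR).
(* With three or more edges, [X] and [X :\ f] would both have even size. *)
have evX := ev X (subxx _) X1; have /set0Pn[f fX] := X0.
move: evX X1 (ev (X :\ f) (subsetDl _ _)); rewrite (cardsD1 f X) fX /= add1n /= negbK.
by case: #|X :\ f| => [|[|n]] //= o _ /(_ isT); rewrite o.
Qed.

Lemma gadget_exists : 2 < #|vset E| -> exists A B R w u v,
  [/\ A :|: B :|: R = E, [disjoint A & B] /\ [disjoint A :|: B & R],
      #|A| = 2 /\ {in A, forall f, inc f = [set w; u]},
      #|B| = 2 /\ {in B, forall f, inc f = [set w; v]} &
      [/\ w != u, w != v, u != v & w \notin vset R]].
Proof.
move=> V2; case: phiE => cE _ _ _ Hc.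
have [P0 tP0] := two_cut_exists V2; case: (@arg_minnP _ P0 two_cut (fun P => #|P|) tP0) => P tP mn.
have /and4P[sP R1 /cards2P[u [v [uv bd]]] P2] := tP.
pose R := E :\: P; rewrite -/R in R1 bd.
have eE : P :|: R = E by apply: setUD_sub.
have dR : [disjoint P & R] by apply: disjointD.
(* A cut of the identified [P] would give, by [incid_split], a strictly smaller part that still has
   a third vertex. *)
have cP : conn2 (incid inc u v) P.
  apply: contraT => nc; have [|X [Y [eXY d X0 Y0 sm]]] := conn2_split _ nc.
    by rewrite -card_gt0 (leq_trans _ (card_vset_gt2 P2)).
  have [t tX tuv] := third_vertex u v P2.
  have main X' Y' : X' :|: Y' = P -> [disjoint X' & Y'] -> X' != set0 -> Y' != set0 ->
      cut_le1 (incid inc u v) X' Y' -> t \in vset X' -> False.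
    move=> eXY' d' X'0 Y'0 sm' tX'.
    have := mn X'; rewrite leqNgt => /(_ _)/negP[].
      apply: (@two_cut_part X' (Y' :|: R) u v t) => //.
      - by rewrite setUA eXY'.
      - by apply: disjointU2 => //; apply: disjointWl dR; rewrite -eXY' subsetUl.
      - by apply: (leq_trans R1); apply: subset_leq_card; apply: subsetUr.
      by apply: incid_split; rewrite ?eXY' ?eE.
    apply: proper_card; rewrite properE -eXY' subsetUl /=; have [y yY] := set0Pn _ Y'0.
    by apply/subsetPn; exists y; rewrite ?inE ?yY ?orbT // (disjointFl d').
  exfalso; move: tX; rewrite -eXY vsetU => /setUP[tX|tY]; first exact: (main X Y).
  by apply: (main Y X); rewrite 1?setUC 1?disjoint_sym //; apply: cut_le1_sym.
have [] := Hc P R u v eE dR (card_vset_gt2 P2) R1 uv bd; rewrite (nblk_conn2 cP) => /esym nP _.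
have nc : ~~ conn2 inc P by apply: contraNN nP => /nblk_conn2->.
have [|X [Y [eXY d X0 Y0 sm]]] := conn2_split _ nc.
  by rewrite -card_gt0 (leq_trans _ (card_vset_gt2 P2)).
rewrite -eXY in eE dR bd mn.
have cXYR : conn2 inc (X :|: Y :|: R) by rewrite eE.
have [a [b [x [eab [aX aY] [bY bX] [xa xb] ix]]]] := chain_split cXYR X0 Y0 d dR bd sm.
rewrite -eab in bd.
have [A2 iA] := piece_double eE d dR R1 bd aX aY bY bX xa xb ix mn.
have [B2 iB] : #|Y| = 2 /\ {in Y, forall f, inc f = [set x; b]}.
  by apply: (@piece_double Y X R b a); rewrite 1?(setUC Y) 1?(disjoint_sym Y) 1?(setUC [set b]) 1?(setIC (vset Y)).
exists X, Y, R, x, a, b; split=> //; split=> //.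
  by apply: contraNneq bX => <-.
apply/negP=> xR; have : x \in [set a; b].
  by rewrite -bd inE xR andbT vsetU inE; have : x \in vset X :&: vset Y by [rewrite ix set11]; case/setIP=> ->.
by rewrite !inE (negPf xa) (negPf xb).
Qed.

(** Contracting one edge turns all others into loops, so (b') makes [#|E|] odd, and (a') rules out a
    single edge. Among five or more edges, three would form a part of odd size, against
    [parallel_even]. *)
Lemma parallel_card3 : #|vset E| = 2 -> #|E| = 3.
Proof.
case: phiE => cE _ cD He _ V2; have /cards2P[u [v [uv eV]]] : #|vset E| == 2 by rewrite V2.
have iE : {in E, forall f, inc f = [set u; v]}.
  by move=> f fE; apply: set2_eq; [rewrite -eV -(vset1 inc) vsetS // sub1set|apply: card_inc_gt1].
have /set0Pn[e eE] := conn2_neq0 cE.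
have lD : nblk (incid inc u v) (E :\ e) = #|E :\ e|.
  apply: (@nblk_loops _ _ _ u) => f; rewrite inE => /andP[_ fE].
  by rewrite /incid iE // imsetU !imset_set1 idptL idptR setUid.
have := He e u v eE (iE e eE); rewrite lD => ev.
have /set0Pn[f fE] := conn2_neq0 (cD e eE).
move: ev; rewrite (cardsD1 e E) (cardsD1 f (E :\ e)) eE fE !add1n /= negbK.
case D3 : #|_| => [|[|n]] //= on; exfalso.
have /set0Pn[g gE] : E :\ e :\ f != set0 by rewrite -card_gt0 D3.
have E3 : #|E :\ e :\ f :\ g| = n.+1 by move: D3; rewrite (cardsD1 g) gE => -[].
have [fe fE' ] : f != e /\ f \in E by apply/andP; rewrite -in_setD1.
have [gf [ge gE']] : g != f /\ g != e /\ g \in E by move: gE; rewrite !inE => /and3P[].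
pose Z := [set e; f; g].
have sZ : Z \subset E by apply/subsetP=> k; rewrite !inE -orbA => /or3P[]/eqP->.
have Z3 : #|Z| = 3.
  by rewrite /Z -setUA cardsU1 cards2 !inE ![e == _]eq_sym (negPf fe) (negPf ge) eq_sym gf.
have eD : E :\: Z = E :\ e :\ f :\ g.
  by apply/setP=> k; rewrite !inE; do 3!case: (k == _).
have pZ : {in Z, forall k, inc k = [set u; v]} by move=> k /(subsetP sZ)/iE.
(* [n] is odd, hence positive, and [n.+1] edges remain outside [Z]. *)
have D2 : 1 < #|E :\: Z| by rewrite eD E3 ltnS; case: n on {D3 E3}.
suff sub : [set u; v] \subset vset (E :\: Z).
  by have := parallel_even sZ pZ uv _ D2 sub; rewrite Z3 => /(_ isT).
have /set0Pn[k kD] : E :\: Z != set0 by rewrite -card_gt0 (leq_trans _ D2).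
rewrite -(iE k); first by rewrite -(vset1 inc) vsetS // sub1set.
by move: kD => /setDP[].
Qed.

End Structure.

(** * Phi and the gadget *)

Section HalfGadget.
Variables (T F : finType) (inc : F -> {set T}).
Implicit Types (E P X Y : {set F}) (x y z : T).

Lemma conn2_eq_in (inc' : F -> {set T}) E : {in E, inc =1 inc'} -> conn2 inc E -> conn2 inc' E.
Proof.
move=> eqE cE; apply: conn2I => [|X Y eXY d X0 Y0 sm]; first exact: conn2_neq0 cE.
apply: (@conn2_not_cut_le1 _ _ inc X Y) => //; first by rewrite eXY.
have sub (Z : {set F}) t : Z \subset E -> t \in vset inc Z -> t \in vset inc' Z.
  by move=> sZ /vsetP[f fZ tf]; apply/vsetP; exists f; rewrite // -eqE ?(subsetP sZ).
have sX : X \subset E by rewrite -eXY subsetUl.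
have sY : Y \subset E by rewrite -eXY subsetUr.
by move=> y z /(sub _ _ sX) yX /(sub _ _ sY) yY /(sub _ _ sX) zX /(sub _ _ sY) zY; apply: sm.
Qed.

Lemma nblk_incid_set2 E x y (x' y' : T) : [set x; y] = [set x'; y'] ->
  nblk (incid inc x y) E = nblk (incid inc x' y') E.
Proof.
move=> e; have : x \in [set x'; y'] by rewrite -e set21.
have : y \in [set x'; y'] by rewrite -e set22.
have : x' \in [set x; y] by rewrite e set21.
have : y' \in [set x; y] by rewrite e set22.
case/set2P=> -> /set2P[] -> //; first by move=> /set2P[] -> _.
  by rewrite nblk_incidC.
by move=> _ /set2P[] ->.
Qed.

Variables (A B Q : {set F}) (w u v : T).
Hypothesis incA : {in A, forall f, inc f = [set w; u]}.
Hypothesis incB : {in B, forall f, inc f = [set w; v]}.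
Hypothesis cA : #|A| = 2.
Hypothesis cB : #|B| = 2.
Hypothesis wu : w != u.
Hypothesis wv : w != v.
Hypothesis uv : u != v.
Hypothesis dAB : [disjoint A & B].
Hypothesis dABQ : [disjoint A :|: B & Q].
Hypothesis wQ : w \notin vset inc Q.

Let vsA : vset inc A = [set w; u] := vset_parallel (card2_neq0 cA) incA.
Let vsB : vset inc B = [set w; v] := vset_parallel (card2_neq0 cB) incB.

Lemma nblk_half : nblk inc A = 1.
Proof. by apply/nblk_conn2/(conn2_parallel (card2_neq0 cA) incA); rewrite cards2 wu. Qed.

Lemma nblk_incid_half : nblk (incid inc w u) A = 2.
Proof.
rewrite -cA; apply: (@nblk_loops _ _ _ w) => f fA.
by rewrite /incid incA // imsetU !imset_set1 idptL idptR setUid.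
Qed.

Lemma cut_le1_AB : cut_le1 inc A B.
Proof.
have sub t : t \in vset inc A -> t \in vset inc B -> t = w.
  by rewrite vsA vsB => /set2P[->//|->] /set2P[//|/eqP]; rewrite (negPf uv).
by move=> y z yX yY zX zY; rewrite (sub y yX yY) (sub z zX zY).
Qed.

Lemma cut_le1_BQ : cut_le1 inc Q B.
Proof.
have sub t : t \in vset inc Q -> t \in vset inc B -> t = v.
  by rewrite vsB => tQ /set2P[tw|//]; rewrite tw (negPf wQ) in tQ.
by move=> y z yX yY zX zY; rewrite (sub y yX yY) (sub z zX zY).
Qed.

(** [A] must meet the other edges in both [w] and [u], and [B] does not contain [u]. *)
Lemma end_in_rest : conn2 inc (A :|: B :|: Q) -> u \in vset inc Q.
Proof.
rewrite -setUA => cG; have [|||y [z [yz]]] := conn2_two cG.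
- exact: (card2_neq0 cA).
- by rewrite setU_eq0 (negPf (card2_neq0 cB)).
- by apply: disjointU2 => //; apply: (disjointUl dABQ).
rewrite vsA => yA zA yBQ zBQ; have : u \in vset inc (B :|: Q).
  have := @set2_other _ y z u w yz; rewrite setUC => /(_ yA zA).
  by case/orP=> /eqP->.
by rewrite vsetU vsB !inE eq_sym (negPf wu) (negPf uv).
Qed.

Hypothesis cQ : conn2 inc Q.
Hypothesis uQ : u \in vset inc Q.
Hypothesis vQ : v \in vset inc Q.

Lemma nblk_rest_half : nblk inc (Q :|: B) = (nblk inc B).+1.
Proof.
rewrite nblk_split ?(nblk_conn2 cQ) //; first exact: cut_le1_BQ.
by rewrite disjoint_sym (disjointUr dABQ).
Qed.

(** Merging [w] into [u] turns the edges of [B] into edges between [u] and [v], both vertices of the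
    2-connected [Q]. *)
Lemma conn2_incid_rest_half : conn2 (incid inc w u) (Q :|: B).
Proof.
(* Keeping the name [u] instead of [w] leaves the incidences of [Q] untouched; a transposition
   restores the required name at the end. *)
pose inc' := incid inc u w; have c' : conn2 inc' (Q :|: B).
  have eQ : {in Q, inc =1 inc'}.
    move=> f fQ; rewrite /inc' /incid -[LHS]imset_id; apply: eq_in_imset => t tf.
    by rewrite /idpt; case: eqP => // tw; case/negP: wQ; rewrite -tw (mem_vset fQ tf).
  apply: conn2_addU; first exact: conn2_eq_in cQ.
  move=> f fB; rewrite /inc' /incid incB // imsetU !imset_set1 idptR /idpt eq_sym (negPf wv).
  rewrite cards2 uv; split=> //; rewrite subUset !sub1set.
  have vsQ t : t \in vset inc Q -> t \in vset inc' Q.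
    by case/vsetP=> g gQ tg; apply/vsetP; exists g; rewrite -?eQ.
  by rewrite !vsQ.
rewrite -[_ :|: _]imset_id (conn2_transport (inc := inc') (g := tperm w u)) //; first exact: perm_inj.
move=> f; rewrite /inc' /incid -imset_comp; apply: eq_imset => x /=; rewrite /idpt.
case: (eqVneq x w) => [->|xw]; first by rewrite tpermR; case: eqVneq.
by case: (eqVneq x u) => [->|xu]; rewrite ?tpermR // tpermD // eq_sym.
Qed.

(** The edge parallel to [f] becomes a loop and everything else is one block, two blocks in all.
    This is where a class of two edges is right for (b'). *)
Lemma contract_half f x y : f \in A -> inc f = [set x; y] ->
  ~~ odd (nblk (incid inc x y) ((A :|: B :|: Q) :\ f)).
Proof.
move=> fA; rewrite (incA fA) => e.
rewrite -(nblk_incid_set2 _ e).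
have /cards1P[g eg] : #|A :\ f| == 1 by have := cA; rewrite (cardsD1 f) fA add1n => -[->].
have gA : g \in A by have : g \in [set g] := set11 g; rewrite -eg => /setD1P[].
have -> : (A :|: B :|: Q) :\ f = [set g] :|: (Q :|: B).
  rewrite -eg -setUA (setUC B) setDUl; congr (_ :|: _).
  apply/setDidPl; rewrite disjoint_sym disjoints1 inE negb_or.
  by rewrite (disjointFr (disjointUl dABQ) fA) (disjointFr dAB fA).
rewrite nblk_split ?nblk_set1 ?(nblk_conn2 conn2_incid_rest_half) //.
  move=> s t; rewrite vset1 /incid (incA gA) // imsetU !imset_set1 idptL idptR setUid.
  by move=> /set1P-> _ /set1P->.
by rewrite disjoints1 inE negb_or (disjointFr (disjointUl dABQ) gA) (disjointFr dAB gA).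
Qed.

End HalfGadget.

(** * The three conditions with the edge and with the gadget *)

Section PhiGadget.
Variables (T F : finType) (inc : F -> {set T}) (e : F) (A B Q : {set F}) (w u v : T).
Hypothesis inc_ends : forall f, exists x y, inc f = [set x; y].
Hypothesis ince : inc e = [set u; v].
Hypothesis incA : {in A, forall f, inc f = [set w; u]}.
Hypothesis incB : {in B, forall f, inc f = [set w; v]}.
Hypothesis cA : #|A| = 2.
Hypothesis cB : #|B| = 2.
Hypothesis wu : w != u.
Hypothesis wv : w != v.
Hypothesis uv : u != v.
Hypothesis dAB : [disjoint A & B].
Hypothesis dABQ : [disjoint A :|: B & Q].
Hypothesis eQ : e \notin Q.
Hypothesis wQ : w \notin vset inc Q.
Implicit Types (P X Y Z : {set F}) (x y z t : T).
Local Notation vset := (vset inc).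
Local Notation Gad P := (A :|: B :|: P).

Let A0 : A != set0 := card2_neq0 cA.
Let B0 : B != set0 := card2_neq0 cB.

Let dBA : [disjoint B & A].
Proof. by rewrite disjoint_sym. Qed.
Let dBAQ : [disjoint B :|: A & Q].
Proof. by rewrite setUC. Qed.

(** As [w] is neither [x] nor [y], the identified gadget is again a gadget, on the images of [u] and
    [v], which may coincide. *)
Lemma gadget_nblk_incid P x y : e \notin P -> [disjoint A :|: B & P] -> w \notin vset P ->
  w != x -> w != y -> linked (incid inc x y) P (idpt x y u) (idpt x y v) ->
  nblk (incid inc x y) (Gad P) = nblk (incid inc x y) (e |: P).
Proof.
move=> eP dP wP wx wy cP.
have fw : idpt x y w = w by rewrite /idpt (negPf wy).
have w_idf t : w != t -> w != idpt x y t by rewrite /idpt; case: (t == y).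
apply: (@gadget_nblk _ _ _ e A B w (idpt x y u) (idpt x y v)) => //.
- by rewrite /incid ince imset_set2.
- by move=> f fA; rewrite /incid incA // imset_set2 fw.
- by move=> f fB; rewrite /incid incB // imset_set2 fw.
- exact: w_idf.
- exact: w_idf.
rewrite vset_identify; apply/imsetP=> -[t tP ew].
have wt : w != t by apply: contraNneq wP => ->.
by have := w_idf t wt; rewrite -ew eqxx.
Qed.

Let subQ P : P \subset Q -> [/\ e \notin P, [disjoint A :|: B & P] & w \notin vset P].
Proof.
move=> sP; split; first by apply: contra eQ; apply: (subsetP sP).
  exact: disjointWr dABQ.
by apply: contra wQ; apply: subsetP; apply: vsetS.
Qed.

(** [P] is a side of (c') with [e] removed. As [Q] is 2-connected, [P] and [Y] still share both [x]
    and [y]; hence [u] and [v] are in [P] and linked there, so [e] is no bridge of its side. *)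
Lemma gadget_nblk_part P Y x y : conn2 inc Q -> u \in vset Q -> v \in vset Q ->
  P :|: Y = Q -> [disjoint P & Y] -> P != set0 -> Y != set0 ->
  vset (e |: P) :&: vset Y = [set x; y] -> x != y ->
  nblk inc (Gad P) = nblk inc (e |: P) /\ nblk (incid inc x y) (Gad P) = nblk (incid inc x y) (e |: P).
Proof.
move=> cQ uQ vQ ePY d P0 Y0 bd xy.
have sP : P \subset Q by rewrite -ePY subsetUl.
have [eP dP wP] := subQ sP.
have bdP : vset P :&: vset Y = [set x; y].
  apply: set2_eq; last by apply: conn2_cut; rewrite ?ePY.
  by rewrite -bd; apply: setSI; apply: vsetS; apply: subsetUr.
have inP t : t \in vset Q -> t \in [set u; v] -> t \in vset P.
  rewrite -ePY vsetU => /setUP[//|tY] tuv.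
  have : t \in vset (e |: P) :&: vset Y by rewrite inE tY vsetU vset1 ince inE tuv.
  by rewrite bd -bdP => /setIP[].
have cn : linked inc P u v.
  apply: (@linked_part _ _ inc P Y u v x y); rewrite ?ePY ?bdP //; apply: inP; rewrite ?set21 ?set22 //.
split; first by apply: (gadget_nblk ince incA incB).
have wxy t : t \in [set x; y] -> w != t.
  by rewrite -bdP => /setIP[tP _]; apply: contraNneq wP => ->.
apply: gadget_nblk_incid => //; rewrite ?wxy ?set21 ?set22 //.
by apply: (linked_incid cn) => f fP; left.
Qed.

Lemma vset_gad P : vset (Gad P) = w |: vset (e |: P).
Proof. by apply: (vset_gadget ince incA incB). Qed.

Lemma vset_gad_capl P Y : P \subset Q -> Y \subset Q -> vset (Gad P) :&: vset Y = vset (e |: P) :&: vset Y.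
Proof.
move=> sP sY; have [_ _ wY] := subQ sY; rewrite vset_gad setIUl.
by rewrite (_ : _ :&: _ = set0) ?set0U //; apply/eqP; rewrite setI_eq0 disjoints1.
Qed.

Lemma nblk_gadget : nblk inc (A :|: B) = 2.
Proof.
rewrite nblk_split //; last exact: (cut_le1_AB incA incB cA cB uv).
by rewrite (nblk_half incA cA wu) (nblk_half incB cB wv).
Qed.

(** The case of an empty [P]: the ends of [e] have merged, so the link is trivial and the gadget
    counts like the loop [e]. *)
Lemma nblk_incid_gadget x y : [set u; v] = [set x; y] -> nblk (incid inc x y) (A :|: B) = 1.
Proof.
move=> exy; rewrite -(nblk_incid_set2 _ _ exy) -[A :|: B]setU0 gadget_nblk_incid ?inE //.
- by rewrite setU0 nblk_set1.
- by rewrite -setI_eq0 setI0.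
- by rewrite vset0 inE.
by rewrite idptL idptR => S ->.
Qed.

Lemma gadgetD1 P f : f \in P -> [disjoint A :|: B & P] -> Gad P :\ f = Gad (P :\ f).
Proof.
move=> fP d; rewrite setDUl; congr (_ :|: _); apply/setDidPl.
by rewrite disjoint_sym disjoints1 (disjointFl d fP).
Qed.

Lemma setU1D1 P f : f \in P -> e \notin P -> (e |: P) :\ f = e |: (P :\ f).
Proof.
move=> fP eP; rewrite setDUl; congr (_ :|: _); apply/setDidPl.
by rewrite disjoints1 inE; apply: contraNneq eP => ->.
Qed.

(** [Q] links [u] and [v], and losing [f] does no harm because its ends are merged. *)
Lemma nblk_contract_gadget f x y : conn2 inc Q -> u \in vset Q -> v \in vset Q -> f \in Q ->
  inc f = [set x; y] ->
  nblk (incid inc x y) (Gad Q :\ f) = nblk (incid inc x y) ((e |: Q) :\ f).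
Proof.
move=> cQ uQ vQ fQ ef; rewrite gadgetD1 // setU1D1 //.
have [eP dP wP] := subQ (subsetDl Q [set f]).
have wxy t : t \in [set x; y] -> w != t.
  by rewrite -ef => tf; apply: contraNneq wQ => ->; apply: mem_vset tf.
apply: gadget_nblk_incid => //; rewrite ?wxy ?set21 ?set22 //.
apply: (linked_incid (conn2_linked cQ uQ vQ)) => g gQ.
case: (eqVneq g f) => [->|gf]; first by right; rewrite ef.
by left; rewrite !inE gf.
Qed.

(** If [Y] had edges of both classes, all of [w], [u], [v] would be shared. So [Y] lies in one
    class, and its two edges exhaust that class. *)
Lemma mixed_cut X Y x y : u \in vset Q -> v \in vset Q -> X :|: Y = Gad Q -> [disjoint X & Y] ->
  Q \subset X -> X :&: (A :|: B) != set0 -> 1 < #|Y| -> vset X :&: vset Y = [set x; y] ->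
  (Y = A /\ X = Q :|: B) \/ (Y = B /\ X = Q :|: A).
Proof.
move=> uQ vQ eXY d sQ XD0 Y1 bd.
have YQ f : f \in Y -> f \in Q -> False.
  by move=> fY /(subsetP sQ) fX; rewrite (disjointFr d fX) in fY.
have sY : Y \subset A :|: B.
  apply/subsetP=> f fY; have : f \in Gad Q by rewrite -eXY inE fY orbT.
  by case/setUP=> // /(YQ f fY).
have uX : u \in vset X by apply: subsetP uQ; apply: vsetS.
have vX : v \in vset X by apply: subsetP vQ; apply: vsetS.
have wX : w \in vset X.
  have [f /setIP[fX /setUP[fA|fB]]] := set0Pn _ XD0; apply: mem_vset fX _.
    by rewrite incA ?set21.
  by rewrite incB ?set21.
have eX : X = Gad Q :\: Y by rewrite -eXY setUC disjoint_setUD // disjoint_sym.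
have half C C' : C :|: C' = A :|: B -> [disjoint C & C'] -> #|C| = 2 -> Y \subset C -> Y = C /\ X = Q :|: C'.
  move=> eC dC C2 sYC; have eY : Y = C by apply/eqP; rewrite eqEcard sYC C2.
  split=> //; rewrite eX eY -eC -setUA disjoint_setUD; first by rewrite setUC.
  apply: disjointU2 => //; apply: disjointWl dABQ; rewrite -eC; exact: subsetUl.
case: (boolP (Y \subset A)) => [YA|/subsetPn[b bY bA]]; first by left; apply: (half A B).
case: (boolP (Y \subset B)) => [YB|/subsetPn[a aY aB]]; first by right; apply: (half B A); rewrite // setUC.
have bB : b \in B by have := subsetP sY b bY; rewrite inE (negPf bA).
have aA : a \in A by have := subsetP sY a aY; rewrite inE (negPf aB) orbF.
have : [set w; u; v] \subset [set x; y].
  rewrite -bd !subUset !sub1set !inE uX vX wX /=; apply/andP; split; first (apply/andP; split).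
  - by apply: mem_vset aY _; rewrite incA ?set21.
  - by apply: mem_vset aY _; rewrite incA ?set22.
  by apply: mem_vset bY _; rewrite incB ?set22.
move/subset_leq_card; rewrite -setUA cardsU1 cards2 uv !inE negb_or wu wv cards2.
by case: eqP.
Qed.

(** In (c') the gadget lies on one side, where it can be traded for [e] unless it is the whole side,
    or it is divided, in which case one of the sides is [A] or [B]. The exceptional sides are
    settled by computing their block numbers. *)
Lemma PhiE_expand : PhiE inc (e |: Q) -> PhiE inc (Gad Q).
Proof.
case=> cH V1 cD He Hc.
have eH : e \in e |: Q := setU11 _ _.
have DQ : (e |: Q) :\ e = Q by apply: setU1K.
have cQ : conn2 inc Q by rewrite -DQ; apply: cD.
have Q0 := conn2_neq0 cQ.
have uvQ : inc e \subset vset Q.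
  by rewrite -DQ; apply: (inc_sub_vsetD inc_ends _ eH); split.
have uQ : u \in vset Q by apply: (subsetP uvQ); rewrite ince set21.
have vQ : v \in vset Q by apply: (subsetP uvQ); rewrite ince set22.
have nbQ := nblk_conn2 cQ.
split.
- by apply: (gadget_conn2 ince incA incB); rewrite ?Q0 ?orbT.
- rewrite vset_gad; apply: (leq_trans V1); apply: subset_leq_card; exact: subsetUr.
- move=> f /setUP[/setUP[fA|fB]|fQ].
  + have -> : Gad Q :\ f = A :\ f :|: B :|: Q.
      rewrite -!setUA setDUl; congr (_ :|: _); apply/setDidPl; rewrite disjoint_sym disjoints1 inE negb_or.
      by rewrite (disjointFr dAB fA) (disjointFr (disjointUl dABQ) fA).
    have [g gA] : exists g, g \in A :\ f by apply/set0Pn; rewrite -card_gt0; move: cA; rewrite (cardsD1 f) fA add1n => -[->].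
    apply: (@gadget_conn2 _ _ inc e _ _ w u v) => //; rewrite ?Q0 ?orbT //.
    * by move=> k /setD1P[_ /incA].
    * by apply/set0Pn; exists g.
  + have -> : Gad Q :\ f = A :|: B :\ f :|: Q.
      rewrite (setUC A) (setUC A) -!setUA setDUl; congr (_ :|: _); apply/setDidPl; rewrite disjoint_sym disjoints1 inE negb_or.
      by rewrite (disjointFl dAB fB) (disjointFr (disjointUr dABQ) fB).
    have [g gB] : exists g, g \in B :\ f by apply/set0Pn; rewrite -card_gt0; move: cB; rewrite (cardsD1 f) fB add1n => -[->].
    apply: (@gadget_conn2 _ _ inc e _ _ w u v) => //; rewrite ?Q0 ?orbT //.
    * by move=> k /setD1P[_ /incB].
    * by apply/set0Pn; exists g.
  rewrite gadgetD1 //; have [eP dP wP] := subQ (subsetDl Q [set f]).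
  apply: (gadget_conn2 ince incA incB) => //.
    by rewrite -setU1D1 //; apply: cD; rewrite inE fQ orbT.
  (* If [f] were all of [Q], contracting it would leave only [e], one block, against (b'). *)
  apply/orP; right; apply/negP=> /eqP Qf0; have [x [y exy]] := inc_ends f.
  have := He f x y _ exy; rewrite inE fQ orbT setU1D1 // Qf0 setU0 nblk_set1.
  by move=> /(_ isT).
- move=> f x y /setUP[/setUP[fA|fB]|fQ] ef.
  + exact: (contract_half incA incB).
  + by rewrite (setUC A); apply: (contract_half incB incA) => //; rewrite eq_sym.
  rewrite nblk_contract_gadget //; apply: He => //; by rewrite inE fQ orbT.
move=> X Y x y eXY d X1 Y1 xy bd.
have X0 : X != set0 by rewrite -card_gt0 (leq_trans _ X1).
have Y0 : Y != set0 by rewrite -card_gt0 (leq_trans _ Y1).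
have side Z Z' : Z :|: Z' = Gad Q -> [disjoint Z & Z'] -> A :|: B \subset Z ->
   exists P, [/\ Z = Gad P, P :|: Z' = Q & [disjoint P & Z']].
  move=> eZ dZ sD; exists (Z :&: Q); split.
  - have sZ : Z \subset Gad Q by rewrite -eZ subsetUl.
    apply/setP=> f; rewrite in_setU in_setI; case: (boolP (f \in A :|: B)) => fD /=.
      by rewrite (subsetP sD).
    case: (boolP (f \in Z)) => //= fZ; have := subsetP sZ f fZ.
    by rewrite in_setU (negPf fD) /= => ->.
  - apply/setP=> f; rewrite in_setU in_setI; case: (boolP (f \in Q)) => fQ; rewrite ?andbT ?andbF /=.
      by rewrite -in_setU eZ in_setU fQ orbT.
    apply/negbTE/negP=> fZ'; have : f \in Gad Q by rewrite -eZ in_setU fZ' orbT.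
    rewrite in_setU (negPf fQ) orbF => /(subsetP sD) fZ.
    by rewrite (disjointFr dZ fZ) in fZ'.
  by apply: disjointWl dZ; apply: subsetIl.
case: (boolP (A :|: B \subset X)) => [sX|nX].
  have [P [eX ePY dP]] := side X Y eXY d sX.
  have sP : P \subset Q by rewrite -ePY subsetUl.
  have sY : Y \subset Q by rewrite -ePY subsetUr.
  have [eP _ _] := subQ sP.
  rewrite eX vset_gad_capl // in bd *.
  (* If [X] is the gadget alone, it has two blocks, one after identification, and [Y = Q] has
     one. *)
  case: (eqVneq P set0) => [P0|P0].
    rewrite P0 set0U in ePY; rewrite P0 !setU0 in bd *.
    rewrite ePY nblk_gadget nbQ nblk_incid_gadget //.
    by rewrite -bd vset1 ePY -ince; apply/esym/setIidPl.
  have [-> ->] := gadget_nblk_part cQ uQ vQ ePY dP P0 Y0 bd xy.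
  apply: Hc => //; first by rewrite -setUA ePY.
    by rewrite disjoint_sym; apply: disjointU2; rewrite disjoint_sym // disjoints1; have [] := subQ sY.
  exact: set0_card_gt1.
case: (boolP (A :|: B \subset Y)) => [sY|nY].
  rewrite setUC in eXY; rewrite disjoint_sym in d; rewrite setIC in bd.
  have [P [eY ePX dP]] := side Y X eXY d sY.
  have sP : P \subset Q by rewrite -ePX subsetUl.
  have sX : X \subset Q by rewrite -ePX subsetUr.
  have [eP _ _] := subQ sP.
  rewrite eY vset_gad_capl // in bd *.
  (* If [Y] is the gadget alone, then [X = Q], whose identification has an even block number by (b')
     for [e]. *)
  case: (eqVneq P set0) => [P0|P0].
    rewrite P0 set0U in ePX; rewrite P0 !setU0 in bd *.
    rewrite ePX nblk_gadget nbQ; split=> //; apply/negbTE; rewrite -DQ; apply: He => //.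
    by rewrite -bd vset1 ePX; apply/esym/setIidPl.
  have [-> _] := gadget_nblk_part cQ uQ vQ ePX dP P0 X0 bd xy.
  apply: Hc => //; first by rewrite setUC -setUA ePX.
  - apply: disjointU2; last by rewrite disjoint_sym.
    by rewrite disjoint_sym disjoints1; have [] := subQ sX.
  - exact: set0_card_gt1.
  by rewrite setIC.
have XD0 : X :&: (A :|: B) != set0.
  apply: contraNneq nY => XD; apply/subsetP=> f fD.
  have : f \in X :|: Y by rewrite eXY inE fD.
  by case/setUP=> // fX; move/setP/(_ f): XD; rewrite !inE in fD *; rewrite fX fD.
have YD0 : Y :&: (A :|: B) != set0.
  apply: contraNneq nX => XD; apply/subsetP=> f fD.
  have : f \in X :|: Y by rewrite eXY inE fD.
  by case/setUP=> // fX; move/setP/(_ f): XD; rewrite !inE in fD *; rewrite fX fD.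
have hasw Z : Z :&: (A :|: B) != set0 -> w \in vset Z.
  case/set0Pn=> f /setIP[fZ /setUP[fA|fB]]; apply: mem_vset fZ _.
    by rewrite incA ?set21.
  by rewrite incB ?set21.
(* Both sides contain [w], so [w] is [x] or [y]. As [w] is not in [Q], the pieces of a divided [Q]
   would share at most one vertex. *)
have sQ : (Q \subset X) || (Q \subset Y).
  case: (boolP (Q \subset X)) => //= /subsetPn[f fQ fX].
  case: (boolP (Q \subset Y)) => //= /subsetPn[g gQ gY].
  have QXY k : k \in Q -> (k \in X) || (k \in Y) by move=> kQ; rewrite -in_setU eXY inE kQ orbT.
  exfalso; apply: (@conn2_not_cut_le1 _ _ inc (Q :&: X) (Q :&: Y)).
  - by rewrite -setIUr eXY (setIidPl _) // subsetUr.
  - by apply/set0Pn; exists g; rewrite inE gQ; have := QXY g gQ; rewrite (negPf gY) orbF.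
  - by apply/set0Pn; exists f; rewrite inE fQ; have := QXY f fQ; rewrite (negPf fX).
  - apply: disjointWl (subsetIr _ _) _; apply: disjointWr d; exact: subsetIr.
  have wxy : w \in [set x; y] by rewrite -bd inE !hasw.
  have sub Z t : t \in vset (Q :&: Z) -> t \in vset Z /\ t != w.
    move=> tZ; split; first by apply: subsetP tZ; apply: vsetS; apply: subsetIr.
    apply: contraNneq wQ => <-; apply: subsetP tZ; apply: vsetS; exact: subsetIl.
  move=> s t /sub[sX sw] /sub[sY _] /sub[tX tw] /sub[tY _].
  have inS : s \in [set x; y] by rewrite -bd inE sX.
  have inT : t \in [set x; y] by rewrite -bd inE tX.
  apply/eqP; apply: contraT => st.
  case/set2P: wxy => ew; last rewrite setUC in inS inT.
    by have := set2_other st inS inT; rewrite -ew ![w == _]eq_sym (negPf sw) (negPf tw).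
  by have := set2_other st inS inT; rewrite -ew ![w == _]eq_sym (negPf sw) (negPf tw).
have nA := nblk_half incA cA wu; have nB := nblk_half incB cB wv.
have nQB : nblk inc (Q :|: B) = 2 by rewrite (nblk_rest_half incB cB dABQ wQ cQ) nB.
have nQA : nblk inc (Q :|: A) = 2 by rewrite (nblk_rest_half incA cA dBAQ wQ cQ) nA.
have vsAE := vset_parallel (card2_neq0 cA) incA; have vsBE := vset_parallel (card2_neq0 cB) incB.
have sAQ : vset A \subset vset (Q :|: B).
  by rewrite vsetU vsAE vsBE subUset !sub1set !inE eqxx uQ !orbT.
have sBQ : vset B \subset vset (Q :|: A).
  by rewrite vsetU vsAE vsBE subUset !sub1set !inE eqxx vQ !orbT.
(* A class has one block, two once its ends are identified; the complementary side has two and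
   one. *)
case/orP: sQ => sQ.
  case: (mixed_cut uQ vQ eXY d sQ XD0 Y1 bd) => -[eY eX]; rewrite eX eY in bd *.
    rewrite nQB nA; split=> //.
    have exy : [set w; u] = [set x; y] by rewrite -bd -vsAE (setIidPr sAQ).
    rewrite -(nblk_incid_set2 _ _ exy) nblk_conn2 //; exact: (conn2_incid_rest_half incB wv uv).
  rewrite nQA nB; split=> //.
  have exy : [set w; v] = [set x; y] by rewrite -bd -vsBE (setIidPr sBQ).
  rewrite -(nblk_incid_set2 _ _ exy) nblk_conn2 //; apply: (conn2_incid_rest_half incA wu) => //; by rewrite eq_sym.
rewrite setUC in eXY; rewrite disjoint_sym in d; rewrite setIC in bd.
case: (mixed_cut uQ vQ eXY d sQ YD0 X1 bd) => -[eX eY]; rewrite eX eY in bd *.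
  rewrite nQB nA; split=> //.
  have exy : [set w; u] = [set x; y] by rewrite -bd -vsAE (setIidPr sAQ).
  by rewrite -(nblk_incid_set2 _ _ exy) (nblk_incid_half incA cA).
rewrite nQA nB; split=> //.
have exy : [set w; v] = [set x; y] by rewrite -bd -vsBE (setIidPr sBQ).
by rewrite -(nblk_incid_set2 _ _ exy) (nblk_incid_half incB cB).
Qed.

(** The point is that [Q], where [e] is absent, is 2-connected. The gadget has two blocks, so (c')
    makes b(Q) odd and b(Q/uv) even. If [Q] had a cut, [necklace] would make Q/uv a single block.
    The even value of b(Q/uv) is also (b') for [e]. *)
Lemma PhiE_reduce : PhiE inc (Gad Q) -> PhiE inc (e |: Q).
Proof.
case=> cG V1 cD He Hc.
have cG' : conn2 inc (B :|: A :|: Q) by rewrite (setUC B).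
have uQ : u \in vset Q := end_in_rest incA incB cA cB wu uv dAB dABQ cG.
have vQ : v \in vset Q by apply: (end_in_rest incB incA cB cA wv _ dBA dBAQ cG'); rewrite eq_sym.
have Q0 := vset_neq0 uQ.
have smAB := cut_le1_AB incA incB cA cB uv.
(* If [Q] were one edge, its deletion would leave the gadget, which is cut at [w], against (a'). *)
have Q1 : 1 < #|Q|.
  rewrite ltnNge; apply/negP=> Q1; have /cards1P[q eq] : #|Q| == 1 by rewrite eqn_leq Q1 card_gt0.
  have := cD q; rewrite eq setUC setU11 setU1K => [/(_ isT)|].
    by move=> cAB; apply: (conn2_not_cut_le1 cAB).
  by rewrite -disjoints1 -eq disjoint_sym.
have D1 : 1 < #|A :|: B|.
  by apply: (leq_trans (_ : 1 < #|A|)); rewrite ?cA // -cA; apply/subset_leq_card/subsetUl.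
have vsD : vset (A :|: B) :&: vset Q = [set u; v].
  rewrite -[A :|: B]setU0 vset_gad_capl ?sub0set // setU0 vset1 ince; apply/setIidPl.
  by rewrite subUset !sub1set uQ.
have [_ ] := Hc _ _ u v erefl dABQ D1 Q1 uv vsD; rewrite nblk_gadget => oQ.
have eQD : Q :|: (A :|: B) = Gad Q by rewrite setUC.
have dQD : [disjoint Q & A :|: B] by rewrite disjoint_sym.
have bdQ : vset Q :&: vset (A :|: B) = [set u; v] by rewrite setIC.
have [iQ _] := Hc _ _ u v eQD dQD Q1 D1 uv bdQ; rewrite oQ /= in iQ.
have cQ : conn2 inc Q.
  apply: contraT => nQ; have [X [Y [eXY d X0 Y0 sm]]] := conn2_split Q0 nQ.
  suff /nblk_conn2 n1 : conn2 (incid inc u v) Q by rewrite n1 in iQ.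
  rewrite -eXY; apply: (@necklace _ _ inc X Y (A :|: B)); rewrite ?eXY //.
  by rewrite setUC.
have DQ : (e |: Q) :\ e = Q by apply: setU1K.
split.
- exact: (gadget_conn2_conv ince incA incB).
- apply: (leq_trans (_ : 1 < #|inc e|)); first by rewrite ince cards2 uv.
  by apply: subset_leq_card; rewrite vsetU vset1 subsetUl.
- move=> f /setU1P[->|fQ]; first by rewrite DQ.
  rewrite setU1D1 //; have [eP dP wP] := subQ (subsetDl Q [set f]).
  apply: (gadget_conn2_conv ince incA incB) => //; rewrite -gadgetD1 //; apply: cD.
  by rewrite inE fQ orbT.
- move=> f x y /setU1P[->|fQ] ef.
    by rewrite ince in ef; rewrite DQ -(nblk_incid_set2 _ _ ef) iQ.
  by rewrite -nblk_contract_gadget //; apply: He => //; rewrite inE fQ orbT.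
have side Z Z' : Z :|: Z' = e |: Q -> [disjoint Z & Z'] -> e \in Z ->
    [/\ Z :\ e :|: Z' = Q, [disjoint Z :\ e & Z'] & e |: (Z :\ e) = Z].
  move=> eZ dZ eZ0; split; last exact: setD1K.
    have eZ' : e \notin Z' by rewrite (disjointFr dZ eZ0).
    by rewrite -DQ -eZ setDUl (setDidPl _ : Z' :\ e = Z') // disjoint_sym disjoints1.
  by apply: disjointWl dZ; apply: subsetDl.
move=> X Y x y eXY d X1 Y1 xy bd.
have X0 : X != set0 by rewrite -card_gt0 (leq_trans _ X1).
have Y0 : Y != set0 by rewrite -card_gt0 (leq_trans _ Y1).
have G1 P : 1 < #|Gad P|.
  by apply: (leq_trans D1); apply/subset_leq_card/subsetUl.
have Pn0 Z : e \in Z -> 1 < #|Z| -> Z :\ e != set0.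
  by move=> eZ; rewrite (cardsD1 e) eZ add1n ltnS card_gt0.
have : e \in X :|: Y by rewrite eXY setU11.
case/setUP=> [eX|eY].
  have [ePY dP eXe] := side X Y eXY d eX.
  have sP : X :\ e \subset Q by rewrite -ePY subsetUl.
  have sY : Y \subset Q by rewrite -ePY subsetUr.
  have [_ dP' _] := subQ sP; have [_ dY' _] := subQ sY.
  rewrite -eXe in bd *.
  have [<- <-] := gadget_nblk_part cQ uQ vQ ePY dP (Pn0 X eX X1) Y0 bd xy.
  apply: Hc => //; first by rewrite -setUA ePY.
    by rewrite disjoint_sym; apply: disjointU2; rewrite disjoint_sym.
  by rewrite vset_gad_capl.
rewrite setUC in eXY; rewrite disjoint_sym in d; rewrite setIC in bd.
have [ePX dP eYe] := side Y X eXY d eY.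
have sP : Y :\ e \subset Q by rewrite -ePX subsetUl.
have sX : X \subset Q by rewrite -ePX subsetUr.
have [_ dP' _] := subQ sP; have [_ dX' _] := subQ sX.
rewrite -eYe in bd *.
have [<- _] := gadget_nblk_part cQ uQ vQ ePX dP (Pn0 Y eY Y1) X0 bd xy.
apply: Hc => //; first by rewrite setUC -setUA ePX.
  by apply: disjointU2; rewrite disjoint_sym.
by rewrite setIC vset_gad_capl.
Qed.

End PhiGadget.

(** * From graphs to edge sets *)

Section Agraph.
Variables (T F : finType).
Implicit Types (G : agraph T F) (x y z t v : T) (X Y : {set F}).

Definition aends_set G f : {set T} := [set (aends G f).1; (aends G f).2].

Lemma set2_pair (p : T * T) x y : [set p.1; p.2] = [set x; y] -> p = (x, y) \/ p = (y, x).
Proof.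
case: p => a b /= e; have : a \in [set x; y] by rewrite -e set21.
have : b \in [set x; y] by rewrite -e set22.
have : x \in [set a; b] by rewrite e set21.
have : y \in [set a; b] by rewrite e set22.
by case/set2P=> -> /set2P[] -> /set2P[] eb /set2P[] ea; subst; auto.
Qed.

Section Nonseparable.
Variable G : agraph T F.
Hypothesis wfG : wf G.
Let inc := aends_set G.
Let V := avert G.
Let E := aedge G.

Lemma wf_ends f : f \in E -> inc f \subset V.
Proof. by move=> fE; move/forall_inP: wfG => /(_ f fE); rewrite subUset !sub1set. Qed.

Lemma wf_vset : vset inc E \subset V.
Proof. by apply/subsetP=> x /vsetP[f fE]; apply: subsetP; apply: wf_ends. Qed.

Lemma adj_ends x y : adj G x y -> exists2 f, f \in E & inc f = [set x; y].
Proof.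
case/and3P=> _ _ /exists_inP[f fE fxy]; exists f => //; rewrite /inc /aends_set.
by case/orP: fxy => /eqP -> //=; rewrite setUC.
Qed.

Lemma ends_adj f x y : f \in E -> x \in inc f -> y \in inc f -> x != y -> adj G x y.
Proof.
move=> fE xf yf xy; have sV := subsetP (wf_ends fE).
apply/and3P; split; [exact: sV|exact: sV|apply/exists_inP; exists f => //].
move: xf yf; rewrite /inc /aends_set [aends G f]surjective_pairing.
move=> /set2P[] ex /set2P[] ey; rewrite ex ey ?eqxx ?orbT //.
  by rewrite ex ey eqxx in xy.
by rewrite ex ey eqxx in xy.
Qed.

Lemma connected_ends x y : connected G -> x \in V -> y \in V -> x != y -> x \in vset inc E.
Proof.
case/andP=> _ /forall_inP/(_ x) cG xV yV xy; move/forall_inP: (cG xV) => /(_ y yV).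
case/connectP=> -[|z p] /= => [_ e|/andP[/adj_ends[f fE ef] _] _].
  by rewrite e eqxx in xy.
by apply: mem_vset fE _; rewrite ef set21.
Qed.

Lemma connected_vset : connected G -> E != set0 -> V = vset inc E.
Proof.
move=> cG /set0Pn[f fE]; apply/eqP; rewrite eqEsubset wf_vset andbT; apply/subsetP=> x xV.
have yf : (aends G f).1 \in inc f by rewrite set21.
case: (eqVneq x (aends G f).1) => [->|xy]; first exact: mem_vset fE yf.
apply: connected_ends cG xV _ xy; exact: (subsetP (wf_ends fE)).
Qed.

Lemma connected_edge : connected G -> 1 < #|V| -> E != set0.
Proof.
move=> cG /card_gt1P[x [y [xV yV xy]]]; exact: vset_neq0 (connected_ends cG xV yV xy).
Qed.

(** A cut without shared vertex disconnects the graph; a cut at one vertex [z] makes [z] a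
    cut-vertex, both sides having another vertex when there are no loops. The exceptional graph has
    a single edge and so no bipartition. *)
Lemma nonsep_conn2 : nonsep G -> E != set0 -> conn2 inc E.
Proof.
case/and3P=> cG /forallP ncut loops E0; have eV := connected_vset cG E0.
apply: conn2I => // X Y eXY d X0 Y0 sm.
have sX : X \subset E by rewrite -eXY subsetUl.
have sY : Y \subset E by rewrite -eXY subsetUr.
have inV t (Z : {set F}) : Z \subset E -> t \in vset inc Z -> t \in V by move=> sZ; rewrite eV; apply: subsetP; apply: vsetS.
have conG x y : x \in V -> y \in V -> connect (adj G) x y.
  by case/andP: cG => _ /forall_inP cG xV yV; move/forall_inP: (cG x xV); apply.
have end1 f : (aends G f).1 \in inc f by rewrite set21.
have end2 f : (aends G f).2 \in inc f by rewrite set22.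
case/orP: loops => [noloop|/andP[_ E1]]; last first.
  have : #|X| + #|Y| = 1 by rewrite -(eqP E1) -/E -eXY cardsU (disjoint_setI0 d) cards0 subn0.
  by move: X0 Y0; rewrite -!card_gt0; case: #|X| => [|[|n]] //; case: #|Y|.
have other (Z : {set F}) z : Z \subset E -> Z != set0 -> exists2 a, a \in vset inc Z & a != z.
  move=> sZ /set0Pn[f fZ]; case: (eqVneq (aends G f).1 z) => [e1|ne]; last by exists (aends G f).1; rewrite // (mem_vset fZ).
  exists (aends G f).2; first exact: mem_vset fZ _.
  apply: contraNneq noloop => e2; apply/exists_inP; exists f; first exact: (subsetP sZ).
  by rewrite /is_loop e1 e2.
case: (set_0Vmem (vset inc X :&: vset inc Y)) => [nsh|[z /setIP[zX zY]]].
  have /set0Pn[f fX] := X0; have /set0Pn[g gY] := Y0.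
  have fX1 := mem_vset fX (end1 f); have gY1 := mem_vset gY (end1 g).
  have := conG _ _ (inV _ _ sX fX1) (inV _ _ sY gY1).
  have cl : closed (adj G) (mem (vset inc X)).
    move=> x y /adj_ends[k kE ek].
    have xk : x \in inc k by rewrite ek set21.
    have yk : y \in inc k by rewrite ek set22.
    move: kE; rewrite -eXY => /setUP[kX|kY]; first by rewrite !(mem_vset kX).
    have nX t : t \in inc k -> t \in vset inc X = false.
      by move=> tk; move/setP/(_ t): nsh; rewrite !inE (mem_vset kY tk) andbT.
    by rewrite !nX.
  move/(closed_connect cl); rewrite fX1 => /esym gX1.
  by move/setP/(_ (aends G g).1): nsh; rewrite !inE gX1 gY1.
have [a aX az] := other X z sX X0; have [b bY bz] := other Y z sY Y0.
have aV := inV _ _ sX aX; have bV := inV _ _ sY bY.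
move/negP: (ncut z); apply; rewrite /cut_vertex -/V (inV _ _ sX zX) /=.
apply/exists_inP; exists a; first by rewrite !inE az.
apply/exists_inP; exists b; first by rewrite !inE bz.
rewrite conG //=; apply/negP.
have cl : closed (adj (del_vertex G z)) (mem (vset inc X)).
  move=> x y /and3P[xV yV /exists_inP[k]]; rewrite inE => /andP[kE _] kxy.
  have [xz yz] : x != z /\ y != z by move: xV yV => /setD1P[? _] /setD1P[].
  have ek : inc k = [set x; y] by rewrite /inc /aends_set; case/orP: kxy => /eqP -> //=; rewrite setUC.
  have xk : x \in inc k by rewrite ek set21.
  have yk : y \in inc k by rewrite ek set22.
  move: kE; rewrite -/E -eXY => /setUP[kX|kY]; first by rewrite !(mem_vset kX).
  have nX t : t \in inc k -> t != z -> t \in vset inc X = false.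
    move=> tk tz; apply: contraNF tz => tX; apply/eqP; apply: sm => //; exact: mem_vset kY tk.
  by rewrite !nX.
move/(closed_connect cl); rewrite aX => /esym bX.
by move/eqP: bz; apply; apply: sm.
Qed.

(** For a cut-vertex [v], the edges meeting one component of the graph without [v] share only [v]
    with the others. A loop shares at most one vertex with other edges, so it is the only edge. *)
Lemma conn2_nonsep : V = vset inc E -> conn2 inc E -> nonsep G.
Proof.
move=> eV cE; have E0 := conn2_neq0 cE.
have end1 f : (aends G f).1 \in inc f by rewrite set21.
have conG x y : x \in V -> y \in V -> connect (adj G) x y.
  rewrite eV => xV yV; apply: contraT => nxy.
  have := conn2_linked cE xV yV (S := [set t | connect (adj G) x t]).
  rewrite !inE => /(_ (connect0 _ _) nxy)/exists_inP[f fE /crossP[[t tf xt] [t' tf' nxt']]].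
  rewrite inE in xt; rewrite inE in nxt'; case/negP: nxt'.
  case: (eqVneq t t') => [<- //|tt']; apply: connect_trans xt (connect1 _).
  exact: (ends_adj fE tf tf' tt').
apply/and3P; split.
- apply/andP; split; last by apply/forall_inP=> x xV; apply/forall_inP=> y; apply: conG.
  have /set0Pn[f fE] := E0; apply/set0Pn; exists (aends G f).1; rewrite -/V eV; exact: mem_vset fE _.
- apply/forallP=> v; apply/negP=> /andP[vV /exists_inP[x /setD1P[xv xV] /exists_inP[y /setD1P[yv yV] /andP[_ nxy]]]].
  pose S := [set t | connect (adj (del_vertex G v)) x t].
  pose X := [set f in E | ~~ [disjoint inc f & S]]; pose Y := E :\: X.
  have sX : X \subset E by apply/subsetP=> f; rewrite inE => /andP[].
  have eXY : X :|: Y = E by apply: setUD_sub.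
  have xS : x \in S by rewrite inE connect0.
  have Sv t : t \in S -> t != v.
    rewrite inE => /connectP[p pth ->]; elim/last_ind: p pth => //= p z _.
    by rewrite rcons_path last_rcons => /andP[_ /and3P[_ /setD1P[]]].
  have YS t : t \in vset inc Y -> t \notin S.
    case/vsetP=> f /setDP[fE +] tf; rewrite inE fE /= negbK => dS.
    by rewrite (disjointFr dS tf).
  have XS t : t \in vset inc X -> t \in S \/ t = v.
    case/vsetP=> f; rewrite inE => /andP[fE /pred0Pn[s /= /andP[sf sS]]] tf.
    case: (eqVneq t v) => [|tv]; first by right.
    left; case: (eqVneq s t) => [<- //|st]; rewrite inE.
    have xs : connect (adj (del_vertex G v)) x s by have := sS; rewrite inE.
    apply: connect_trans xs (connect1 _).
    have /and3P[sV tV /exists_inP[k kE kst]] := ends_adj fE sf tf st.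
    have sv := Sv s sS.
    apply/and3P; split; rewrite ?inE /= ?sv ?tv //; apply/exists_inP; exists k => //.
    by rewrite inE kE /=; case/orP: kst => /eqP -> /=; rewrite sv tv.
  have xX : x \in vset inc X.
    by move: xV; rewrite -/V eV -eXY vsetU => /setUP[//|/YS]; rewrite xS.
  have yY : y \in vset inc Y.
    move: yV; rewrite -/V eV -eXY vsetU => /setUP[/XS[yS|yv']|//].
      by rewrite inE (negPf nxy) in yS.
    by rewrite yv' eqxx in yv.
  have cXY : conn2 inc (X :|: Y) by rewrite eXY.
  apply: (conn2_not_cut_le1 cXY (vset_neq0 xX) (vset_neq0 yY) (disjointD _ _)).
  have sub t : t \in vset inc X -> t \in vset inc Y -> t = v.
    by move=> /XS[tS /YS|//]; rewrite tS.
  by move=> s t sX' sY tX tY; rewrite (sub s sX' sY) (sub t tX tY).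
case: (boolP (has_loop G)) => //= /exists_inP[f fE lf].
have ef : inc f = [set (aends G f).1] by rewrite /inc /aends_set -(eqP lf) setUid.
have eE : E = [set f].
  case: (eqVneq (E :\ f) set0) => [E1|E1].
    by have := setD1K (fE : f \in E); rewrite E1 setU0.
  exfalso; have cf : conn2 inc ([set f] :|: E :\ f) by rewrite setD1K.
  apply: (conn2_not_cut_le1 cf _ E1 (disjoint1D _ _)); first by apply/set0Pn; exists f; rewrite set11.
  by move=> s t; rewrite vset1 ef => /set1P-> _ /set1P->.
by rewrite -/V eV -/E eE vset1 ef !cards1.
Qed.

End Nonseparable.

(** A nonseparable subgraph with an edge is connected, so its vertices are those covered by its
    edges; [m] thus carries maximal 2-connected edge sets to blocks. *)
Lemma nblocksE G : wf G -> nblocks G = nblk (aends_set G) (aedge G).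
Proof.
move=> wfG; rewrite /nblocks /nblk.
pose m A := (vset (aends_set G) A, A) : {set T} * {set F}.
have m_inj : injective m by move=> A B [].
rewrite -(card_imset _ m_inj); congr #|pred_of_set _|; apply/setP=> -[P1 P2]; rewrite inE /=.
have subP (A : {set F}) : A \subset aedge G -> is_subgraph G (m A).
  move=> sA; rewrite /is_subgraph sA (subset_trans (vsetS _ sA)) ?wf_vset //=.
  apply/forall_inP=> f fA /=; rewrite !(mem_vset fA) //; by rewrite ?set21 ?set22.
have sub_conn2 (p : {set T} * {set F}) : is_subgraph G p -> nonsep (sub G p) -> p.2 != set0 ->
    p = m p.2 /\ conn2 (aends_set G) p.2.
  case/and3P=> _ _ wfp np p0; split; last exact: (nonsep_conn2 wfp).
  case/and3P: (np) => cp _ _; case: p wfp np p0 cp => p1 p2 /= wfp np p0 cp.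
  by rewrite /m -(connected_vset wfp cp p0).
have conn2_sub (A : {set F}) : A \subset aedge G -> conn2 (aends_set G) A -> nonsep (sub G (m A)).
  by move=> sA cA; have /and3P[_ _ wfA] := subP A sA; apply: (conn2_nonsep wfA).
apply/andP/imsetP => [[/and3P[sP nP /forallP mP] P0]|[A]].
  have [eP cP] := sub_conn2 _ sP nP P0; exists P2 => //.
  have sP2 : P2 \subset aedge G by case/and3P: sP.
  rewrite inE; apply/maxsetP; rewrite sP2 cP; split=> // B /andP[sB cB] sPB.
  have /implyP := mP (m B); rewrite subP // conn2_sub // sPB !andbT /=.
  by case: eP => ->; rewrite vsetS // => /(_ isT)/eqP[].
rewrite inE => /maxsetP[/andP[sA cA] mA] [-> ->]; split; last exact: conn2_neq0 cA.
apply/and3P; split; [exact: subP|exact: conn2_sub|apply/forallP=> q].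
apply/implyP=> /and4P[sq sA1 sA2 nq]; have [|eq cq] := sub_conn2 q sq nq.
  by apply: contraNneq (conn2_neq0 cA) => q0; rewrite -subset0 -q0.
by rewrite eq (mA q.2) // cq andbT; case/and3P: sq.
Qed.

Lemma wf_identify G x y : wf G -> x \in avert G -> wf (identify G x y).
Proof.
move=> wfG xV; rewrite /identify; case: ifP => // xy; apply/forall_inP=> f /= fE.
have /andP[f1 f2] := forall_inP wfG f fE.
have inD t : t \in avert G -> (if t == y then x else t) \in avert G :\ y.
  by move=> tV; rewrite in_setD1; case: (eqVneq t y) => [_|->] //=; rewrite xy.
by rewrite !inD.
Qed.

Lemma nblocks_identify G x y : wf G -> x \in avert G ->
  nblocks (identify G x y) = nblk (incid (aends_set G) x y) (aedge G).
Proof.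
move=> wfG xV; rewrite nblocksE; last exact: wf_identify.
rewrite /identify; case: eqVneq => [->|xy].
  apply: nblk_ext => f; rewrite /incid -[LHS]imset_id; apply: eq_imset => t.
  by rewrite /idpt; case: eqP.
by apply: nblk_ext => f; rewrite /incid /aends_set imset_set2.
Qed.

End Agraph.

(** * Phi in terms of edge sets *)

Definition mends_set (G : mgraph) (f : medge G) : {set mvert G} := [set (mends f).1; (mends f).2].

Lemma mends_set_pair (G : mgraph) (f : medge G) : exists x y, mends_set f = [set x; y].
Proof. by exists (mends f).1, (mends f).2. Qed.

Lemma wf_toA (G : mgraph) : wf (toA G).
Proof. by apply/forall_inP=> f _; rewrite !inE. Qed.

(** The second conjunct excludes isolated vertices of [G], which connectedness does in [Phi]. In
    (c') the boundary is taken between vertex sets in [Phi] and between covered vertices in [PhiE];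
    they agree because the edge parts of a 2-connected graph share at least two vertices. *)
Lemma PhiP (G : mgraph) : Phi G <-> PhiE (@mends_set G) setT /\ vset (@mends_set G) setT = setT.
Proof.
have wfD e : wf (del_edge (toA G) e) by apply/forall_inP=> f _; rewrite !inE.
have eD e x y : nblk (incid (@mends_set G) x y) (setT :\ e) = nblocks (identify (del_edge (toA G) e) x y).
  by rewrite (@nblocks_identify _ _ (del_edge (toA G) e)) // inE.
have wfp (p : {set mvert G} * {set medge G}) : is_subgraph (toA G) p -> wf (sub (toA G) p).
  by case/and3P.
split=> [[ns V2 nsD ev par]|[[cE V1 cD ev par] eV]].
  have cG : connected (toA G) by case/and3P: ns.
  have E0 := connected_edge cG V2.
  have eV : setT = vset (@mends_set G) setT := connected_vset (wf_toA G) cG E0.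
  split=> //; split.
  - exact: (nonsep_conn2 (wf_toA G)).
  - by rewrite -eV.
  - move=> e eE; have nD := nsD e eE; apply: (nonsep_conn2 (wfD e) nD).
    by apply: (connected_edge (G := del_edge (toA G) e)) V2; case/and3P: nD.
  - move=> e x y eE ee; rewrite -(nblk_incid_set2 _ _ ee) eD; exact: ev.
  move=> X Y x y eXY d X1 Y1 xy bd.
  have sg (Z : {set medge G}) : is_subgraph (toA G) (vset (@mends_set G) Z, Z).
    rewrite /is_subgraph !subsetT /=; apply/forall_inP=> f fZ /=.
    by rewrite !(mem_vset fZ) // ?set21 ?set22.
  have xX : x \in vset (@mends_set G) X by have := set21 x y; rewrite -bd => /setIP[].
  have [|||] := par _ _ x y (sg X) (sg Y) X1 Y1 xy bd => //=.
  - by rewrite -vsetU eXY.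
  - exact: disjoint_setI0.
  rewrite nblocks_identify ?(wfp _ (sg _)) //= !nblocksE ?(wfp _ (sg _)) //=.
(* Deleting an edge uncovers no vertex, as [conn2_nonsep] requires. *)
have eD' e : vset (@mends_set G) (setT :\ e) = setT.
  have sD := @inc_sub_vsetD _ _ (@mends_set G) setT (@mends_set_pair G) (And5 cE V1 cD ev par) e (in_setT e).
  by rewrite -eV -{2}(setD1K (in_setT e)) vsetU vset1 (setUidPr sD).
split.
- by apply: (conn2_nonsep (wf_toA G)) => //; rewrite /= eV.
- by rewrite /= -eV.
- by move=> e eE; apply: (conn2_nonsep (wfD e)); rewrite /= ?eD' //; apply: cD.
- by move=> e eE; rewrite /contract -eD; apply: ev.
move=> p1 p2 x y s1 s2 c1 conn2' xy iv uv ie ue.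
have d12 : [disjoint p1.2 & p2.2] by rewrite -setI_eq0 ie.
have s1' : vset (@mends_set G) p1.2 \subset p1.1 := wf_vset (wfp _ s1).
have s2' : vset (@mends_set G) p2.2 \subset p2.1 := wf_vset (wfp _ s2).
rewrite nblocks_identify ?wfp //=; last first.
  by have : x \in [set x; y] := set21 x y; rewrite -iv => /setIP[].
rewrite !nblocksE ?wfp //=; apply: par => //; apply: set2_eq; first by rewrite -iv setISS.
apply: conn2_cut => //; first by rewrite ue.
  by rewrite -card_gt0 (leq_trans _ c1).
by rewrite -card_gt0 (leq_trans _ conn2').
Qed.

Lemma Phi_iso (G H : mgraph) : iso G H -> Phi G <-> Phi H.
Proof.
case=> fv [fe [bv be E]].
have eH f : mends_set (fe f) = fv @: mends_set f.
  by rewrite /mends_set imset_set2; case: (E f) => -> //=; rewrite setUC.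
have iT (T1 T2 : finType) (k : T1 -> T2) : bijective k -> k @: setT = setT.
  by case=> k' kk' k'k; apply/setP=> x; rewrite inE -(k'k x) imset_f.
have iv := bij_inj bv; have ie := bij_inj be.
rewrite !PhiP -(iT _ _ fe be) (PhiE_transport ie iv eH) (vset_transport eH) -(iT _ _ fv bv).
by split=> -[? e]; split=> //; [rewrite e|apply: (imset_inj iv)].
Qed.

(** * The gadget as an operation on graphs *)

Section Extend.
Variables (G : mgraph) (e : medge G).
Hypothesis e_ends : (mends e).1 != (mends e).2.

(* G and extend e both embed in this graph, which has e as well as the gadget. *)
Let F' := (medge G + 'I_4)%type.
Let amb (x : F') : {set option (mvert G)} := match x with
  | inl f => Some @: mends_set f
  | inr i => [set None; Some (if nat_of_ord i < 2 then (mends e).1 else (mends e).2)]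
  end.
Let A : {set F'} := inr @: [set i : 'I_4 | nat_of_ord i < 2].
Let B : {set F'} := inr @: [set i : 'I_4 | ~~ (nat_of_ord i < 2)].
Let Q : {set F'} := inl @: (setT :\ e).
Let h (x : medge (extend e)) : F' := match x with inl f => inl (val f) | inr i => inr i end.

Lemma Phi_extend : Phi (extend e) <-> Phi G.
Proof.
have inl_inj : injective (@inl (medge G) 'I_4) by move=> x y [].
have inr_inj : injective (@inr (medge G) 'I_4) by move=> x y [].
have Some_inj : injective (@Some (mvert G)) by move=> x y [].
have h_inj : injective h by move=> [x|x] [y|y] //= []; [move/val_inj->|move->].
(* [extend e] already has the ambient vertex type, so only its edges are renamed. *)
have hE f : amb (h f) = id @: mends_set f.
  by rewrite imset_id; case: f => [f|i] //=; rewrite /mends_set imset_set2.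
have eQ : inl e |: Q = inl @: setT.
  by rewrite -[setT](setD1K (in_setT e)) imsetU imset_set1.
have eAB : A :|: B :|: Q = h @: setT.
  apply/setP=> x; rewrite !inE; apply/idP/imsetP => [|[[f|i] _ ->] /=].
  - case: x => [f|i]; last by exists (inr i).
    case/orP=> [/orP[]/imsetP[]//|]; rewrite (mem_imset _ _ inl_inj) !inE andbT => fe.
    by exists (inl (Sub f fe)).
  - by rewrite (mem_imset _ _ inl_inj) !inE andbT (valP f) orbT.
  by rewrite !(mem_imset _ _ inr_inj) !inE; case: (_ < 2).
have Phi_eq : PhiE amb (A :|: B :|: Q) <-> PhiE amb (inl e |: Q).
  have ends x : exists y z, amb x = [set y; z].
    case: x => [f|i] /=; last by eexists; eexists.
    by exists (Some (mends f).1), (Some (mends f).2); rewrite imset_set2.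
  have iA : {in A, forall f, amb f = [set None; Some (mends e).1]}.
    by move=> _ /imsetP[i + ->] /=; rewrite inE => ->.
  have iB : {in B, forall f, amb f = [set None; Some (mends e).2]}.
    by move=> _ /imsetP[i + ->] /=; rewrite inE => /negPf->.
  have cA : #|A| = 2.
    by rewrite card_imset // cardsE -sum1_card big_mkcond !big_ord_recl big_ord0.
  have cB : #|B| = 2.
    by rewrite card_imset // cardsE -sum1_card big_mkcond !big_ord_recl big_ord0.
  have dAB : [disjoint A & B].
    rewrite -setI_eq0 -imsetI; last by move=> x y _ _; apply: inr_inj.
    by rewrite imset_eq0; apply/eqP/setP=> i; rewrite !inE andbN.
  have dQ : [disjoint A :|: B & Q].
    rewrite -setI_eq0; apply/eqP/setP=> x; rewrite !inE; apply/negP=> /andP[xAB /imsetP[f _ xf]].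
    by case/orP: xAB => /imsetP[i _]; rewrite xf.
  have ie : amb (inl e) = [set Some (mends e).1; Some (mends e).2] by rewrite /= imset_set2.
  have eQ' : inl e \notin Q by rewrite (mem_imset _ _ inl_inj) !inE eqxx.
  have wQ : None \notin vset amb Q.
    by apply/vsetP=> -[_ /imsetP[f _ ->] /imsetP[]].
  split.
    by apply: (PhiE_reduce (w := None) (u := Some (mends e).1) (v := Some (mends e).2)).
  by apply: (PhiE_expand (w := None) (u := Some (mends e).1) (v := Some (mends e).2)).
have iid : injective (@id (option (mvert G))) by move=> ?.
have P1 := PhiE_transport h_inj iid hE setT.
have inlE f : amb (inl f) = Some @: mends_set f by [].
have P2 := PhiE_transport inl_inj Some_inj inlE setT.
have v1 : vset (@mends_set (extend e)) setT = None |: Some @: vset (@mends_set G) setT.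
  rewrite -[LHS]imset_id -(vset_transport hE) -eAB -(vset_transport inlE) -eQ.
  apply: (@vset_gadget _ _ amb (inl e) A B None (Some (mends e).1) (Some (mends e).2)).
  - by rewrite /= imset_set2.
  - by move=> _ /imsetP[i + ->] /=; rewrite inE => ->.
  - by move=> _ /imsetP[i + ->] /=; rewrite inE => /negPf->.
  - by apply/set0Pn; exists (inr ord0); rewrite (mem_imset _ _ inr_inj) inE.
  by apply/set0Pn; exists (inr ord_max); rewrite (mem_imset _ _ inr_inj) inE.
rewrite !PhiP -P1 -eAB Phi_eq eQ P2 v1.
suff -> : (None |: Some @: vset (@mends_set G) setT = setT) <-> (vset (@mends_set G) setT = setT) by [].
split=> [/setP H|->]; apply/setP.
  by move=> x; have := H (Some x); rewrite !inE /= (mem_imset _ _ Some_inj).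
by case=> [x|]; rewrite !inE //= (mem_imset _ _ Some_inj) inE.
Qed.

End Extend.

Lemma Phi_no_loop (G : mgraph) (e : medge G) : Phi G -> (mends e).1 != (mends e).2.
Proof.
case/PhiP=> phi _; have := card_inc_gt1 phi (in_setT e).
by rewrite cards2; case: eqP.
Qed.

(** Contracting an edge leaves two loops, hence two blocks; (c') is vacuous, three edges being too
    few for two parts of two. *)
Lemma Phi_Z3 : Phi Z3.
Proof.
apply/PhiP; have i3 (f : medge Z3) : mends_set f = setT.
  by apply/setP=> -[[|[|]] // i]; rewrite !inE -!val_eqE.
have card3 : #|[set: medge Z3]| = 3 by rewrite cardsT card_ord.
have conn2Z (E : {set medge Z3}) : E != set0 -> conn2 (@mends_set Z3) E.
  by move=> E0; apply: (@conn2_parallel _ _ _ setT) => //; rewrite cardsT card_ord.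
have D2 e : #|[set: medge Z3] :\ e| = 2.
  by have := card3; rewrite (cardsD1 e) inE add1n => -[].
have E0 : [set: medge Z3] != set0 by rewrite -card_gt0 card3.
have vT : vset (@mends_set Z3) setT = setT.
  by apply/eqP; rewrite eqEsubset subsetT -(i3 ord0) -(vset1 (@mends_set Z3)) vsetS ?subsetT.
split=> //; split.
- exact: conn2Z.
- by rewrite vT cardsT card_ord.
- by move=> e _; apply: conn2Z; rewrite -card_gt0 D2.
- move=> e x y _ ee; rewrite (@nblk_loops _ _ _ x) ?D2 // => f _.
  by rewrite /incid i3 -(i3 e) ee imset_set2 idptL idptR setUid.
move=> X Y x y eXY d X1 Y1; exfalso.
have : #|X| + #|Y| = 3 by rewrite -card3 -eXY cardsU (disjoint_setI0 d) cards0 subn0.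
by move: X1 Y1; case: #|X| => [|[|a]] //; case: #|Y| => [|[|b]] //; rewrite !addSn !addnS.
Qed.

Lemma inj_surj_bij (T1 T2 : finType) (f : T1 -> T2) : injective f ->
  (forall y, exists x, f x = y) -> bijective f.
Proof.
move=> fi fs; have fc y : y \in codom f by have [x <-] := fs y; apply: codom_f.
by exists (fun y => iinv (fc y)) => x; [apply: fi|]; rewrite f_iinv.
Qed.

Lemma Phi_small (G : mgraph) : Phi G -> #|mvert G| = 2 -> iso Z3 G.
Proof.
case/PhiP=> phi eV V2.
have E3 : #|medge G| = 3 by rewrite -cardsT; apply: (parallel_card3 phi); rewrite eV cardsT.
pose fv (i : 'I_2) : mvert G := enum_val (cast_ord (esym V2) i).
pose fe (i : 'I_3) : medge G := enum_val (cast_ord (esym E3) i).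
have iv : injective fv by move=> i j /enum_val_inj/cast_ord_inj.
have ie : injective fe by move=> i j /enum_val_inj/cast_ord_inj.
exists fv, fe; split=> [||i]; try by apply: inj_card_bij; rewrite ?card_ord ?V2 ?E3.
have H : mends_set (fe i) = [set fv ord0; fv ord_max].
  have eT (S : {set mvert G}) : 1 < #|S| -> S = setT.
    by move=> S1; apply/eqP; rewrite eqEcard subsetT cardsT V2.
  have -> : mends_set (fe i) = setT by apply/eT/(card_inc_gt1 phi (in_setT _)).
  by apply/esym/eT; rewrite cards2 (inj_eq iv).
by case: (set2_pair H) => ->; [left|right].
Qed.

(** * Undoing the gadget *)

Section Reduction.
Variables (G : mgraph) (R : {set medge G}) (a1 a2 b1 b2 : medge G) (w u v : mvert G).
Hypothesis wu : u != w.
Hypothesis wv : v != w.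
Hypothesis wR : w \notin vset (@mends_set G) R.

Let u' : {x | x != w} := Sub u wu.
Let v' : {x | x != w} := Sub v wv.

(** [None] is the restored edge between [u] and [v]. The default [u'] of [insubd] is never reached,
    since [w] is no end of an edge of [R]. *)
Definition reduction := @MGraph {x | x != w} (option {f | f \in R})
  (fun x => if x is Some f then (insubd u' (mends (val f)).1, insubd u' (mends (val f)).2)
            else (u', v')).

(** The value [a1] under [inl] is a placeholder: [None] is the edge that [extend] deletes. Indices 0
    and 1 go to the class at [u], 2 and 3 to the class at [v], as in [extend]. *)
Let fe (x : medge (@extend reduction None)) : medge G := match x with
  | inl f => if val f is Some g then val g else a1
  | inr i => if nat_of_ord i == 0 then a1 else if nat_of_ord i == 1 then a2
             else if nat_of_ord i == 2 then b1 else b2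
  end.

Lemma reduction_iso : [set a1; a2] :|: [set b1; b2] :|: R = setT -> a1 != a2 -> b1 != b2 ->
  [disjoint [set a1; a2] & [set b1; b2]] -> [disjoint [set a1; a2] :|: [set b1; b2] & R] ->
  mends_set a1 = [set w; u] -> mends_set a2 = [set w; u] -> mends_set b1 = [set w; v] -> mends_set b2 = [set w; v] ->
  iso (@extend reduction None) G.
Proof.
move=> eT a12 b12 dab dR ia1 ia2 ib1 ib2.
exists (fun x : option (mvert reduction) => if x is Some y then val y else w), fe.
have nR f : f \in [set a1; a2] :|: [set b1; b2] -> f \in R = false by move/(disjointFr dR).
have fe_inr i : fe (inr i) \in [set a1; a2] :|: [set b1; b2].
  by rewrite /= !inE; do ![case: ifP => _]; rewrite eqxx ?orbT.
have fe_inl f : fe (inl f) \in R by case: f => -[g|] //= _; apply: valP.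
have ab f g : f \in [set a1; a2] -> g \in [set b1; b2] -> f != g.
  by move=> fa gb; apply: contraTneq fa => ->; rewrite (disjointFl dab gb).
split.
- exists (fun x => insub x) => [[[x xw]|]|x] /=.
  + by rewrite insubT.
  + by rewrite insubF // eqxx.
  by case: insubP => [y _ //|]; rewrite negbK => /eqP.
- apply: inj_surj_bij => [x y|f].
    case: x => [x|i]; case: y => [y|j] exy.
    + congr inl; apply: val_inj; move: exy => /=; case: x => -[x|] //= _; case: y => -[y|] //= _.
      by move/val_inj ->.
    + by have := fe_inl x; rewrite exy nR.
    + by have := fe_inl y; rewrite -exy nR.
    have [] := (ab a1 b1, ab a1 b2); have [] := (ab a2 b1, ab a2 b2).
    rewrite !inE !eqxx !orbT => /(_ isT isT)/negPf n1 /(_ isT isT)/negPf n2 /(_ isT isT)/negPf n3 /(_ isT isT)/negPf n4.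
    congr inr; apply: val_inj; move: exy => /eqP.
    have ne := (n1, n2, n3, n4, negPf a12, negPf b12).
    by case: i => [[|[|[|[|]]]] // ?]; case: j => [[|[|[|[|]]]] // ?] //=;
      first [rewrite ne|rewrite eq_sym ne].
  have : f \in [set a1; a2] :|: [set b1; b2] :|: R by rewrite eT inE.
  rewrite !inE -!orbA => /or4P[/eqP->|/eqP->|/eqP->|].
  + by exists (inr (@Ordinal 4 0 isT)).
  + by exists (inr (@Ordinal 4 1 isT)).
  + by exists (inr (@Ordinal 4 2 isT)).
  case/orP=> [/eqP->|fR]; first by exists (inr (@Ordinal 4 3 isT)).
  by exists (inl (exist _ (Some (exist _ f fR)) isT)).
case=> [[[g|] //= _]|i].
  have gR := valP g; left.
  have nw t : t \in mends_set (val g) -> val (insubd u' t) = t.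
    by move=> tg; rewrite val_insubd; case: eqP => //= tw; case/negP: wR; rewrite -tw; apply: mem_vset gR tg.
  by rewrite /= !nw ?set21 ?set22 //; case: (mends _).
have H : mends_set (fe (inr i)) = [set w; if nat_of_ord i < 2 then u else v].
  by case: i => [[|[|[|[|]]]]].
rewrite /=; case: (set2_pair H) => /= ->; [left|right]; by case: ifP.
Qed.

End Reduction.

(** Undoing a gadget replaces four edges by one, so the number of edges decreases; [Phi_extend] and
    [Phi_iso] return the conditions to the smaller graph. *)
Lemma Phi_Theta n (G : mgraph) : #|medge G| < n -> Phi G -> Theta G.
Proof.
elim: n G => // n IH G Gn phG; have /PhiP[phi eV] := phG.
have V1 : 1 < #|mvert G| by rewrite -cardsT -eV; case: phi.
move: V1; rewrite leq_eqVlt => /orP[/eqP V2|V2].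
  by apply: Theta_Z3; apply: Phi_small.
have [|A [B [R [w [u [v [eE [dAB dR] [A2 iA] [B2 iB] [wu wv uv wR]]]]]]]] := gadget_exists (@mends_set_pair G) phi.
  by rewrite eV cardsT.
have cG : #|medge G| = #|R| + 4.
  by rewrite -cardsT -eE cardsU (disjoint_setI0 dR) cardsU (disjoint_setI0 dAB) !cards0 !subn0 A2 B2 addnC.
move/eqP/cards2P: A2 => [a1 [a2 [a12 eA]]]; move/eqP/cards2P: B2 => [b1 [b2 [b12 eB]]].
subst A B.
rewrite eq_sym in wu; rewrite eq_sym in wv.
have isoG : iso (@extend (reduction R wu wv) None) G.
  by apply: (reduction_iso wu wv wR eE a12 b12 dAB dR); [apply: iA|apply: iA|apply: iB|apply: iB]; rewrite !inE eqxx ?orbT.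
apply: (Theta_ext _ isoG); apply: IH.
  rewrite card_option card_sig (eq_card (B := R)) //.
  by move: Gn; rewrite cG !addnS addn0 ltnS; apply: leq_trans; rewrite leqW // leqW.
by apply/(@Phi_extend (reduction R wu wv) None uv)/(Phi_iso isoG).
Qed.

Theorem theorem4p6 : forall G : mgraph, Phi G <-> Theta G.
Proof.
move=> G; split; first exact: (@Phi_Theta #|medge G|.+1).
elim=> [H /Phi_iso <-|{}G e H _ phG /Phi_iso <-]; first exact: Phi_Z3.
by apply/Phi_extend => //; apply: Phi_no_loop.
Qed.
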